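(* Consider the monic Jacobi polynomials $\tilde P_n^{(\alpha,\beta)}(x)$ with $\alpha\ne\beta$ and $\alpha+\beta\notin\{-2,-3,-4,\dots\}$. The following are generating functions of the form $A(t)F(xtA(t)-R(t))$ for the indicated polynomial sets. (1) For $\beta=\alpha+1$, $\alpha\neq-\frac12$: $A(t)=\big(1-\frac t2\big)^{-\frac{2}{2\alpha+1}}$, $R(t)=\big(1+\frac{t^2}{4}\big)A(t)-1$, $F(t)=(1-t)^{-(\alpha+\frac32)}$, giving $$\sum_{n\ge0}\frac{(\alpha+\frac32)_n}{n!}\tilde P_n^{(\alpha,\alpha+1)}(x)t^n=\Big(1-\frac t2\Big)\Big(1-xt+\frac{t^2}{4}\Big)^{-(\alpha+\frac32)}.$$ (2) For $(\alpha,\beta)=(0,1)$: $A(t)=\big(1+\frac t2\big)^{-2}$, $R(t)=\big(1+\frac{t^2}{4}\big)A(t)-1$, $F(t)={}_2F_1\big(\frac32,1;2;t\big)$, giving $$\sum_{n\ge0}\frac{(\frac32)_n}{(n+1)!}\tilde P_n^{(0,1)}(x)t^n=\frac{1}{(1+\frac t2)^2}\;{}_2F_1\Big(\tfrac32,1;2;\frac{(x+1)t}{(1+\frac t2)^2}\Big).$$ (3) For $\beta=1-\alpha$ and $R_0\in\{1,-1\}$ with $\frac32+\frac{2\alpha-1}{2R_0}\notin\{0,-1,-2,\dots\}$: $A(t)=\frac{1}{(1-t)^2}$, $R(t)=\frac{R_0}{2}(1+t^2)A(t)-\frac{R_0}{2}$, $F(t)={}_2F_1\big(\frac32,1;\frac32+\frac{2\alpha-1}{2R_0};\frac{2}{R_0}t\big)$,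 giving $$\sum_{n\ge0}\frac{(\frac32)_n}{\big(\frac32+\frac{2\alpha-1}{2R_0}\big)_n}\tilde P_n^{(\alpha,1-\alpha)}(x)\Big(\frac{2t}{R_0}\Big)^n=\frac{1}{(1-t)^2}\;{}_2F_1\Big(\tfrac32,1;\tfrac32+\tfrac{2\alpha-1}{2R_0};\frac{2t(x-R_0)}{R_0(1-t)^2}\Big).$$ Conversely, these are the only ones: every generating function of the form $A(t)F(xtA(t)-R(t))$ of a set $\{\tilde P_n^{(\alpha,\beta)}\}$ with $\alpha\ne\beta$ is, up to rescaling of $t$ and reflection, one of those listed above.
   Context: All power series are formal power series with complex coefficients; $\alpha,\beta$ are complex parameters. $(\mu)_0=1$, $(\mu)_n=\mu(\mu+1)\cdots(\mu+n-1)$. A monic polynomial set (MPS) is a sequence $\{P_n(x)\}_{n\ge0}$ with $P_n(x)=x^n+$ lower degree terms. Generating function of the form $A(t)F(xtA(t)-R(t))$ for an MPS $\{P_n\}$: data $\big((\alpha_n)_{n\ge0},A,R,F\big)$ where $\alpha_n\in\mathbb C$, $\alpha_n\ne0$ for all $n$, $\alpha_0=1$, $F(t)=\sum_{n\ge0}\alpha_nt^n$, and $A,R$ are formal power series with $A(0)=1$, $R(0)=0$, such that $$A(t)F(xtA(t)-R(t))=\sum_{n\ge0}\alpha_nP_n(x)t^n$$ as formal power series in $t$ with coefficients in $\mathbb C[x]$. Rescaling of $t$ by $c\in\mathbb C\setminus\{0\}$ is $(\alpha_n,A(t),R(t),F(t))\mapsto(c^n\alpha_n,A(ct),c^{-1}R(ct),F(ct))$,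 which gives another generating function of the same MPS. Reflection: since $\tilde P_n^{(\alpha,\beta)}(-x)=(-1)^n\tilde P_n^{(\beta,\alpha)}(x)$, a generating function $(\alpha_n,A(t),R(t),F(t))$ of $\{\tilde P_n^{(\alpha,\beta)}\}$ yields the generating function $(\alpha_n,A(-t),R(-t),F(t))$ of $\{\tilde P_n^{(\beta,\alpha)}\}$. The monic Jacobi polynomials are $$\tilde P_n^{(\alpha,\beta)}(x)=\frac{2^n(\alpha+1)_n}{(n+\alpha+\beta+1)_n}\,{}_2F_1\Big(-n,\,n+\alpha+\beta+1;\,\alpha+1;\,\tfrac{1-x}{2}\Big)=\frac{2^n}{(n+\alpha+\beta+1)_n}\sum_{k=0}^n\frac{(-n)_k(n+\alpha+\beta+1)_k(\alpha+1+k)_{n-k}}{k!}\Big(\frac{1-x}{2}\Big)^k,$$ the last expression being used when $\alpha$ is a negative integer. *)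

(* Defs.v *)
From HB Require Import structures.
From mathcomp Require Import all_boot all_order all_algebra.
From mathcomp Require Import boolp reals complex ring.

Set Implicit Arguments.
Unset Strict Implicit.
Unset Printing Implicit Defensive.

Import GRing.Theory.
Local Open Scope ring_scope.

(** A record rather than a bare function type, so that [*] is the Cauchy
    product and not the pointwise product of functions. *)
Record fps (R : Type) := Fps { fps_coef :> nat -> R }.

HB.instance Definition _ (R : Type) := gen_eqMixin (fps R).
HB.instance Definition _ (R : Type) := gen_choiceMixin (fps R).

Lemma fps_ext (R : Type) (A B : fps R) : (forall n, A n = B n) -> A = B.
Proof. by case: A B => [a] [b] /= e; congr Fps; apply/funext. Qed.

Section Zmod.
Variable R : zmodType.
Implicit Types A B : fps R.

Definition fps_zero : fps R := Fps (fun=> 0).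
Definition fps_opp A := Fps (fun n => - A n).
Definition fps_add A B := Fps (fun n => A n + B n).

Let addA : associative fps_add.
Proof. by move=> A B C; apply: fps_ext => n /=; rewrite addrA. Qed.
Let addC : commutative fps_add.
Proof. by move=> A B; apply: fps_ext => n /=; rewrite addrC. Qed.
Let add0 : left_id fps_zero fps_add.
Proof. by move=> A; apply: fps_ext => n /=; rewrite add0r. Qed.
Let addN : left_inverse fps_zero fps_opp fps_add.
Proof. by move=> A; apply: fps_ext => n /=; rewrite addNr. Qed.

HB.instance Definition _ := GRing.isZmodule.Build (fps R) addA addC add0 addN.

Lemma fps0E n : (0 : fps R) n = 0. Proof. by []. Qed.
Lemma fpsDE A B n : (A + B) n = A n + B n. Proof. by []. Qed.
Lemma fpsNE A n : (- A) n = - A n. Proof. by []. Qed.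
Lemma fpsBE A B n : (A - B) n = A n - B n. Proof. by []. Qed.
End Zmod.

Section Ring.
Variable R : comNzRingType.
Implicit Types A B : fps R.

Definition fps_one : fps R := Fps (fun n => (n == 0)%:R).
Definition fps_mul A B := Fps (fun n => \sum_(i < n.+1) A i * B (n - i)%N).

(** Ring identities are transferred from polynomials through truncations. *)
Definition fps_trunc m A : {poly R} := \poly_(i < m) A i.

Let mul_trunc A B m n : (n < m)%N ->
  fps_mul A B n = (fps_trunc m A * fps_trunc m B)`_n.
Proof.
move=> nm; rewrite coefM; apply: eq_bigr => i _ /=.
have im : (i < m)%N by apply: leq_ltn_trans nm; rewrite -ltnS ltn_ord.
by rewrite !coef_poly im (leq_ltn_trans (leq_subr _ _) nm).
Qed.

Let mulC : commutative fps_mul.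
Proof.
by move=> A B; apply: fps_ext => n; rewrite !(mul_trunc _ _ (ltnSn n)) mulrC.
Qed.

Let mulA : associative fps_mul.
Proof.
move=> A B C; apply: fps_ext => n.
transitivity ((fps_trunc n.+1 A * (fps_trunc n.+1 B * fps_trunc n.+1 C))`_n).
  rewrite coefM; apply: eq_bigr => i _.
  by rewrite coef_poly ltn_ord (@mul_trunc _ _ n.+1) // ltnS leq_subr.
rewrite mulrA coefM; apply: eq_bigr => i _.
by rewrite -mul_trunc // coef_poly ltnS leq_subr.
Qed.

Let mul1 : left_id fps_one fps_mul.
Proof.
move=> A; apply: fps_ext => n; rewrite /= big_ord_recl /= mul1r subn0.
by rewrite big1 ?addr0 // => i _; rewrite /= mul0r.
Qed.

Let mulDl : left_distributive fps_mul +%R.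
Proof.
move=> A B C; apply: fps_ext => n; rewrite /= -big_split /=.
by apply: eq_bigr => i _; rewrite mulrDl.
Qed.

Let one_neq0 : fps_one != 0.
Proof.
by apply/eqP => /(congr1 (fun A : fps R => A 0%N)) /eqP; rewrite oner_eq0.
Qed.

HB.instance Definition _ :=
  GRing.Zmodule_isComNzRing.Build (fps R) mulA mulC mul1 mulDl one_neq0.

Lemma fps1E n : (1 : fps R) n = (n == 0)%:R. Proof. by []. Qed.
Lemma fpsME A B n : (A * B) n = \sum_(i < n.+1) A i * B (n - i)%N.
Proof. by []. Qed.

Definition fps_scale (c : R) A := Fps (fun n => c * A n).

Let scaleA a b A : fps_scale a (fps_scale b A) = fps_scale (a * b) A.
Proof. by apply: fps_ext => n /=; rewrite mulrA. Qed.
Let scale1 : left_id 1 fps_scale.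
Proof. by move=> A; apply: fps_ext => n /=; rewrite mul1r. Qed.
Let scaleDr : right_distributive fps_scale +%R.
Proof. by move=> c A B; apply: fps_ext => n /=; rewrite mulrDr. Qed.
Let scaleDl A : {morph fps_scale^~ A : a b / a + b}.
Proof. by move=> a b; apply: fps_ext => n /=; rewrite mulrDl. Qed.

HB.instance Definition _ :=
  GRing.Zmodule_isLmodule.Build R (fps R) scaleA scale1 scaleDr scaleDl.

Let scaleAl c A B : c *: (A * B) = (c *: A) * B.
Proof.
apply: fps_ext => n; rewrite /= mulr_sumr.
by apply: eq_bigr => i _; rewrite mulrA.
Qed.

HB.instance Definition _ :=
  GRing.Lmodule_isLalgebra.Build R (fps R) scaleAl.
HB.instance Definition _ := GRing.Lalgebra_isComAlgebra.Build R (fps R).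

Lemma fpsZE c A n : (c *: A) n = c * A n. Proof. by []. Qed.

Definition fps_t : fps R := Fps (fun n => (n == 1)%:R).

(** [F(G(t))], meaningful when [G 0 = 0]: then [(G ^+ k) n = 0] for [n < k],
    so the coefficient of [t^n] is the finite sum below. *)
Definition fps_comp (F G : fps R) : fps R :=
  Fps (fun n => \sum_(k < n.+1) F k * (G ^+ k) n).

End Ring.

Notation "''t'" := (fps_t _) (at level 0) : ring_scope.

(** A series over [K] seen as a series over [K[x]]. *)
Definition fps_polyC (K : nzRingType) (A : fps K) : fps {poly K} :=
  Fps (fun n => (A n)%:P).

Section Special.
Variable K : fieldType.
Implicit Types (mu a b c : K) (n : nat).

Definition poch mu n : K := \prod_(i < n) (mu + i%:R).

(** [(1 + t)^mu], with the generalized binomial coefficients. *)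
Definition fps_binom mu : fps K :=
  Fps (fun n => (\prod_(i < n) (mu - i%:R)) / n`!%:R).

(** [G^mu] for a series [G] with constant term [1], over [K] and over [K[x]]. *)
Definition fps_pow (G : fps K) mu : fps K := fps_comp (fps_binom mu) (G - 1).
Definition fps_ppow (G : fps {poly K}) mu : fps {poly K} :=
  fps_comp (fps_polyC (fps_binom mu)) (G - 1).

(** [2F1(a, b; c; t)], for [c] not a nonpositive integer. *)
Definition hyp2F1 a b c : fps K :=
  Fps (fun n => poch a n * poch b n / (poch c n * n`!%:R)).

(** The expression of the monic Jacobi polynomial that is valid for all
    [alpha]; [jacobi_hyp2F1] below is the hypergeometric form. *)
Definition jacobi (alpha beta : K) n : {poly K} :=
  (2 ^+ n / poch (n%:R + alpha + beta + 1) n) *: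
  \sum_(k < n.+1)
    (poch (- n%:R) k * poch (n%:R + alpha + beta + 1) k
       * poch (alpha + 1 + k%:R) (n - k) / k`!%:R) *: (2^-1 *: (1 - 'X)) ^+ k.

Lemma pochD mu k m : poch mu (k + m) = poch mu k * poch (mu + k%:R) m.
Proof.
rewrite /poch big_split_ord /=; congr (_ * _).
by apply: eq_bigr => i _; rewrite natrD addrA.
Qed.

Lemma jacobi_hyp2F1 (alpha beta : K) n :
  (forall m : nat, alpha != - m.+1%:R) ->
  jacobi alpha beta n =
    (2 ^+ n * poch (alpha + 1) n / poch (n%:R + alpha + beta + 1) n) *:
    \sum_(k < n.+1)
      hyp2F1 (- n%:R) (n%:R + alpha + beta + 1) (alpha + 1) k
        *: (2^-1 *: (1 - 'X)) ^+ k.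
Proof.
move=> ha; have nz k : poch (alpha + 1) k != 0.
  by apply/prodf_neq0 => i _; rewrite -addrA (addrC 1) natr1 addr_eq0 ha.
rewrite /jacobi mulrAC -[in RHS]scalerA; congr (_ *: _).
rewrite scaler_sumr; apply: eq_bigr => k _; rewrite scalerA; congr (_ *: _).
have -> : poch (alpha + 1) n
          = poch (alpha + 1) k * poch (alpha + 1 + k%:R) (n - k).
  by rewrite -pochD subnKC // -ltnS.
rewrite /= invfM.
set u := poch (- _) _; set v := poch (_ + beta + 1) _.
set w := poch (_ + k%:R) _; set z := _^-1; have := nz k.
set y := poch _ k => y0; rewrite [RHS](_ : _ = u * v * w * z * (y / y)); last by ring.
by rewrite mulfV ?mulr1.
Qed.

End Special.

Section GeneratingFunctions.
Variable K : fieldType.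

Definition is_mps (P : nat -> {poly K}) : Prop :=
  forall n, P n \is monic /\ size (P n) = n.+1.

Record gf_data := GFData {
  gf_coef : nat -> K;
  gf_A : fps K;
  gf_R : fps K;
  gf_F : fps K }.

Record is_gf (P : nat -> {poly K}) (D : gf_data) : Prop := IsGF {
  gf_mps : is_mps P;
  gf_coef_neq0 : forall n, gf_coef D n != 0;
  gf_coef0 : gf_coef D 0 = 1;
  gf_FE : gf_F D = Fps (gf_coef D);
  gf_A0 : gf_A D 0 = 1;
  gf_R0 : gf_R D 0 = 0;
  gf_identity :
    fps_polyC (gf_A D)
      * fps_comp (fps_polyC (gf_F D))
                 ('X *: ('t * fps_polyC (gf_A D)) - fps_polyC (gf_R D))
    = Fps (fun n => gf_coef D n *: P n) }.

Definition gf_rescale (c : K) (D : gf_data) : gf_data :=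
  GFData (fun n => c ^+ n * gf_coef D n)
         (fps_comp (gf_A D) (c *: 't))
         (c^-1 *: fps_comp (gf_R D) (c *: 't))
         (fps_comp (gf_F D) (c *: 't)).

Definition gf_reflect (D : gf_data) : gf_data :=
  GFData (gf_coef D)
         (fps_comp (gf_A D) (- 't))
         (fps_comp (gf_R D) (- 't))
         (gf_F D).

(** [beta = alpha + 1] *)
Definition jacobi_gf1 (alpha : K) : gf_data :=
  let A := fps_pow (1 - 2^-1 *: 't) (- (2 / (2 * alpha + 1))) in
  GFData (fun n => poch (alpha + 3 / 2) n / n`!%:R)
         A
         ((1 + 4^-1 *: 't ^+ 2) * A - 1)
         (fps_pow (1 - 't) (- (alpha + 3 / 2))).

(** [(alpha, beta) = (0, 1)] *)
Definition jacobi_gf2 : gf_data :=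
  let A := fps_pow (1 + 2^-1 *: 't) (- 2) in
  GFData (fun n => poch (3 / 2) n / n.+1`!%:R)
         A
         ((1 + 4^-1 *: 't ^+ 2) * A - 1)
         (hyp2F1 (3 / 2) 1 2).

(** The third hypergeometric parameter when [beta = 1 - alpha]. *)
Definition jacobi_c3 (alpha R0 : K) : K := 3 / 2 + (2 * alpha - 1) / (2 * R0).

(** [beta = 1 - alpha], [R0 = 1] or [R0 = -1] *)
Definition jacobi_gf3 (alpha R0 : K) : gf_data :=
  let A := fps_pow (1 - 't) (- 2) in
  GFData (fun n => poch (3 / 2) n / poch (jacobi_c3 alpha R0) n * (2 / R0) ^+ n)
         A
         ((R0 / 2) *: ((1 + 't ^+ 2) * A) - (R0 / 2)%:A)
         (fps_comp (hyp2F1 (3 / 2) 1 (jacobi_c3 alpha R0)) ((2 / R0) *: 't)).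

Definition jacobi_gf_listed (alpha beta : K) (D : gf_data) : Prop :=
  [\/ [/\ beta = alpha + 1, alpha != - 2^-1 & D = jacobi_gf1 alpha],
      [/\ alpha = 0, beta = 1 & D = jacobi_gf2]
    | beta = 1 - alpha /\
      exists R0 : K,
        [/\ R0 = 1 \/ R0 = -1,
            forall m : nat, jacobi_c3 alpha R0 != - m%:R
          & D = jacobi_gf3 alpha R0]].

End GeneratingFunctions.

(* Main.v *)
Require Import Defs.
From HB Require Import structures.
From mathcomp Require Import all_boot all_order all_algebra.
From mathcomp Require Import boolp reals complex ring.

Set Implicit Arguments.
Unset Strict Implicit.
Unset Printing Implicit Defensive.

Import GRing.Theory Num.Theory.
Local Open Scope ring_scope.

(** The proof has two independent halves. Write [s = alpha + beta],
    [dl = alpha - beta] and [P_n] for the monic Jacobi polynomials.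

    The listed series do generate the [P_n]. In each case the argument
    [x t A - R] simplifies because of the special form of [R]: when
    [beta = alpha + 1] one finds that [1 - (x t A - R)] is
    [A (1 - x t + t^2 / 4)], and in the other two cases [x t A - R] is a
    multiple of [(x - R0) t A]. After this the whole series can be expanded in
    powers of [x - 1], its coefficients being coefficients of powers of
    [1 - c t], and they are compared with the hypergeometric coefficients of
    [P_n] by means of the duplication formula [poch_dup]
    ([jacobi_taylor_case1], [jacobi_taylor_case3]). Expansions at [-1] follow by
    the reflection [x := - x]; it is available because [P_n] is the only monic
    solution of degree [n] of the Jacobi differential equation
    ([jacobi_rec_uniq], [jacobi_reflect]). The case [(0, 1)] is the case
    [beta = 1 - alpha], [R0 = -1] after a rescaling of [t]. Complex powers of
    series are handled through the equation [G theta(H) = mu theta(G) H] for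
    [H = G^mu], where [theta = t d/dt], which has a unique solution with
    constant term 1 ([fps_power_uniq]).

    Conversely, let [A F(x t A - R)] generate the [P_n], with
    [F = sum_n a_n t^n]. Comparing the coefficients of [x^(n-i) t^n] for
    [i = 1, 2, 3] gives three families of equations, indexed by [n]. With
    [N = 2 n + s], the first one is [a_(n-1) A_1 / a_n = R_1 + dl / N]
    ([gf_ratio]): up to rescaling, all the [a_n] depend on [r = R_1] only. The
    other two are then identities between rational functions of [N], valid at
    infinitely many points and so everywhere; their residues and their value at
    infinity force either [s = 1] and [r^2 = 1], or [dl^2 = 1] and
    [r = - dl / s] ([second_order_roots], [classify_parameters]). These are
    exactly the parameters of the list, up to reflection. Finally [A] and [R]
    are determined by the [a_n], since [a_1^2 <> a_0 a_2] when [dl <> 0]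
    ([gf_uniq]); so the given data coincide with the rescaled data of the
    list. *)

(** * Coefficients of products, powers and composites *)

Section FpsCoef.
Variable R : comNzRingType.
Implicit Types (A B E F U : fps R) (c : R).

Lemma fps_coef_sum (I : Type) (r : seq I) (P : pred I) (G : I -> fps R) n :
  (\sum_(i <- r | P i) G i) n = \sum_(i <- r | P i) G i n.
Proof.
exact: (big_morph (fun A : fps R => A n) (fun A B => fpsDE A B n) (fps0E R n)).
Qed.

Lemma fps_coef_mulrn A k n : (A *+ k) n = A n *+ k.
Proof. by elim: k => [|k IH]; rewrite ?mulr0n // !mulrS fpsDE IH. Qed.

Lemma fps_mul0 A B : (A * B) 0%N = A 0%N * B 0%N.
Proof. by rewrite fpsME big_ord1. Qed.

Lemma fps_mul01 A B : A 0%N = 1 -> B 0%N = 1 -> (A * B) 0%N = 1.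
Proof. by move=> A0 B0; rewrite fps_mul0 A0 B0 mulr1. Qed.

Lemma fps_exp0 A k : (A ^+ k) 0%N = A 0%N ^+ k.
Proof. by elim: k => [|k IH]; rewrite ?expr0 // !exprS fps_mul0 IH. Qed.

Lemma fps_mul_t A n : ('t * A) n = if n is m.+1 then A m else 0.
Proof.
case: n => [|n]; first by rewrite fps_mul0 mul0r.
rewrite fpsME 2!big_ord_recl /= mul0r add0r mul1r subSS subn0.
by rewrite big1 ?addr0 // => i _; rewrite mul0r.
Qed.

Lemma fps_mul_tX A k n :
  ('t ^+ k * A) n = if (k <= n)%N then A (n - k)%N else 0.
Proof.
elim: k n => [|k IH] n; first by rewrite expr0 mul1r subn0.
by rewrite exprS -mulrA fps_mul_t; case: n => [|n] //; rewrite IH.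
Qed.

(** The workhorse of all comparisons of coefficients by induction on the
    degree: below its order a series is invisible. *)
Lemma fps_mul_low E B n :
  (forall k, (k < n)%N -> E k = 0) -> (E * B) n = E n * B 0%N.
Proof.
move=> E0; rewrite fpsME big_ord_recr /= subnn big1 ?add0r // => i _.
by rewrite E0 ?mul0r.
Qed.

Lemma fps_exp_low U k n : U 0%N = 0 -> (n < k)%N -> (U ^+ k) n = 0.
Proof.
move=> U0; elim: k n => [//|k IH] n; rewrite ltnS exprSr => nk.
rewrite fps_mul_low ?U0 ?mulr0 // => m mn.
by rewrite IH // (leq_trans mn nk).
Qed.

Lemma fps_comp_widen F U n m : U 0%N = 0 -> (n < m)%N ->
  fps_comp F U n = \sum_(k < m) F k * (U ^+ k) n.
Proof.
move=> U0 nm /=; rewrite (big_ord_widen _ (fun k => F k * (U ^+ k) n) nm).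
rewrite big_mkcond; apply: eq_bigr => k _; case: ltnP => // nk.
by rewrite fps_exp_low ?mulr0.
Qed.

Lemma fps_comp0 F U : fps_comp F U 0%N = F 0%N.
Proof. by rewrite /= big_ord1 expr0 mulr1. Qed.

Lemma fps_mul_comp A F U n : U 0%N = 0 ->
  (A * fps_comp F U) n = \sum_(k < n.+1) F k * (A * U ^+ k) n.
Proof.
move=> U0; rewrite fpsME.
under eq_bigr => i _.
  rewrite (@fps_comp_widen _ _ _ n.+1) ?ltnS ?leq_subr // mulr_sumr.
  over.
rewrite exchange_big; apply: eq_bigr => k _ /=; rewrite mulr_sumr.
by apply: eq_bigr => i _; rewrite mulrCA.
Qed.

Lemma fps_comp_t F U : U 0%N = 0 -> fps_comp ('t * F) U = U * fps_comp F U.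
Proof.
move=> U0; apply: fps_ext => n.
rewrite fps_mul_comp // (@fps_comp_widen _ _ _ n.+2) //.
rewrite big_ord_recl fps_mul_t mul0r add0r; apply: eq_bigr => k _.
by rewrite fps_mul_t exprS.
Qed.

Lemma fps_compD F B U : fps_comp (F + B) U = fps_comp F U + fps_comp B U.
Proof.
apply: fps_ext => n; rewrite /= -big_split; apply: eq_bigr => k _.
by rewrite mulrDl.
Qed.

Lemma fps_compZ c F U : fps_comp (c *: F) U = c *: fps_comp F U.
Proof.
apply: fps_ext => n; rewrite /= mulr_sumr; apply: eq_bigr => k _.
by rewrite mulrA.
Qed.

Lemma fps_comp_scale_t c F n : fps_comp F (c *: 't) n = c ^+ n * F n.
Proof.
rewrite /= big_ord_recr /= big1 ?add0r => [|k _].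
  by rewrite exprZn fpsZE -['t ^+ n]mulr1 fps_mul_tX leqnn subnn mulr1 mulrC.
rewrite exprZn fpsZE -['t ^+ _]mulr1 fps_mul_tX ltnW // fps1E subn_eq0.
by rewrite leqNgt ltn_ord !mulr0.
Qed.

Lemma fps_comp_comp_scale c F U :
  fps_comp (fps_comp F (c *: 't)) U = fps_comp F (c *: U).
Proof.
apply: fps_ext => n; apply: eq_bigr => k _.
by rewrite fps_comp_scale_t exprZn fpsZE mulrCA mulrA.
Qed.

(** The Euler derivation [t d/dt]; compared with [d/dt] it does not shift the
    coefficients, which makes the product rule immediate. *)
Definition fps_theta A : fps R := Fps (fun n => A n *+ n).

Lemma fps_thetaE A n : fps_theta A n = A n *+ n. Proof. by []. Qed.

Lemma fps_thetaM A B :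
  fps_theta (A * B) = fps_theta A * B + A * fps_theta B.
Proof.
apply: fps_ext => n; rewrite fpsDE /= -big_split -sumrMnl /=.
apply: eq_bigr => i _.
by rewrite mulrnAl mulrnAr -mulrnDr subnKC // -ltnS.
Qed.

Lemma fps_thetaX A k :
  fps_theta (A ^+ k.+1) = (A ^+ k * fps_theta A) *+ k.+1.
Proof.
elim: k => [|k IH]; first by rewrite expr0 mul1r.
rewrite exprS fps_thetaM IH mulrnAr [RHS]mulrS; congr (_ + _ *+ _).
  by rewrite mulrC.
by rewrite mulrA -exprS.
Qed.

Definition fps_deriv A : fps R := Fps (fun n => A n.+1 *+ n.+1).

Lemma fps_theta_comp F U : U 0%N = 0 ->
  fps_theta (fps_comp F U) = fps_theta U * fps_comp (fps_deriv F) U.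
Proof.
move=> U0; apply: fps_ext => n; rewrite fps_mul_comp //.
rewrite [LHS](_ : _ = fps_comp F U n *+ n) //.
rewrite (@fps_comp_widen _ _ _ n.+2) // -sumrMnl big_ord_recl.
rewrite -mulrnAr expr0 fps1E.
have -> : (n == 0)%:R *+ n = 0 :> R by case: n => [|n]; rewrite ?mulr0n ?mul0rn.
rewrite mulr0 add0r; apply: eq_bigr => k _.
rewrite -mulrnAr -[LHS]/(F k.+1 * fps_theta (U ^+ k.+1) n) fps_thetaX.
by rewrite fps_coef_mulrn mulrnAr -mulrnAl mulrC [_ * fps_theta U]mulrC mulrC.
Qed.

(** The hypothesis on [F] is the equation [(1 + t) F' = mu F] of the binomial
    series; composed with [G - 1] it becomes the equation
    [G theta(H) = mu theta(G) H], which characterises [H = G^mu] and serves as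
    the definition of a power in all that follows. *)
Lemma fps_comp_power_eq (mu : R) F (G : fps R) : G 0%N = 1 ->
  (forall n, F n.+1 *+ n.+1 + F n *+ n = mu * F n) ->
  G * fps_theta (fps_comp F (G - 1)) = mu *: (fps_theta G * fps_comp F (G - 1)).
Proof.
move=> G0 rec; have U0 : (G - 1) 0%N = 0 by rewrite fpsBE G0 fps1E subrr.
have thetaU : fps_theta (G - 1) = fps_theta G.
  apply: fps_ext => n; rewrite /= mulrnBl; case: n => [|n].
    by rewrite !mulr0n subrr.
  by rewrite /= mul0rn subr0.
rewrite fps_theta_comp // thetaU mulrCA scalerAr -fps_compZ; congr (_ * _).
rewrite -{1}(subrK 1 G) addrC mulrDl mul1r -fps_comp_t // -fps_compD.
congr fps_comp; apply: fps_ext => n; rewrite fpsDE fps_mul_t fpsZE -rec.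
by case: n.
Qed.
End FpsCoef.

(** The coefficients of [H] are determined one after the other, because
    [G 0 = 1] leaves [n H_n] as the top term of the coefficient of [t^n]. *)
Lemma fps_power_uniq (R : idomainType) (mu : R) (G H H' : fps R) :
  (forall n, n.+1%:R != 0 :> R) -> G 0%N = 1 -> H 0%N = H' 0%N ->
  G * fps_theta H = mu *: (fps_theta G * H) ->
  G * fps_theta H' = mu *: (fps_theta G * H') -> H = H'.
Proof.
move=> char0 G0 H0 eH eH'; apply/eqP; rewrite -subr_eq0; apply/eqP.
set E := H - H'.
have thetaE : fps_theta E = fps_theta H - fps_theta H'.
  by apply: fps_ext => n; rewrite /= mulrnBl.
have eE : fps_theta E * G = E * (mu *: fps_theta G).
  by rewrite thetaE mulrC mulrBr eH eH' -scalerBr -mulrBr -scalerAr mulrC.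
apply: fps_ext => n; rewrite fps0E; elim/ltn_ind: n => -[|n] IH.
  by rewrite fpsBE H0 subrr.
have := congr1 (fun A : fps R => A n.+1) eE.
rewrite !fps_mul_low // ?G0 => [|k kn]; last by rewrite fps_thetaE IH ?mul0rn.
rewrite mulr1 fpsZE !fps_thetaE mulr0n !mulr0 -mulr_natr => /eqP.
by rewrite mulf_eq0 (negPf (char0 n)) orbF => /eqP.
Qed.

(** * Powers with an arbitrary exponent *)

Section PolyCoefficients.
Variable K : comNzRingType.
Implicit Types (A F U : fps K) (c : K).

Lemma fps_polyC_is_zmod_morphism : zmod_morphism (@fps_polyC K).
Proof. by move=> A B; apply: fps_ext => n /=; rewrite polyCB. Qed.

Lemma fps_polyC_is_monoid_morphism : monoid_morphism (@fps_polyC K).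
Proof.
split=> [|A B]; apply: fps_ext => n.
  by rewrite /= polyC_natr.
by rewrite /= rmorph_sum; apply: eq_bigr => i _; rewrite rmorphM.
Qed.

HB.instance Definition _ := GRing.isZmodMorphism.Build (fps K) (fps {poly K})
  (@fps_polyC K) fps_polyC_is_zmod_morphism.
HB.instance Definition _ := GRing.isMonoidMorphism.Build (fps K) (fps {poly K})
  (@fps_polyC K) fps_polyC_is_monoid_morphism.

Lemma fps_polyC_inj : injective (@fps_polyC K).
Proof.
move=> A B /(congr1 (@fps_coef _)) e; apply: fps_ext => n.
exact: polyC_inj (congr1 (fun f => f n) e).
Qed.

Lemma fps_polyC_t : fps_polyC 't = 't :> fps {poly K}.
Proof. by apply: fps_ext => n /=; case: eqP. Qed.

Lemma fps_polyCZ c A : fps_polyC (c *: A) = c%:P *: fps_polyC A.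
Proof. by apply: fps_ext => n /=; rewrite polyCM. Qed.

Lemma fps_polyC_comp F U :
  fps_polyC (fps_comp F U) = fps_comp (fps_polyC F) (fps_polyC U).
Proof.
apply: fps_ext => n; rewrite /= rmorph_sum; apply: eq_bigr => k _.
by rewrite -rmorphXn /= polyCM.
Qed.

End PolyCoefficients.

Lemma fps_mulI (R : comNzRingType) (P A B : fps R) :
  P 0%N = 1 -> P * A = P * B -> A = B.
Proof.
move=> P0 e; apply/eqP; rewrite -subr_eq0; apply/eqP.
have {}e : (A - B) * P = 0 by rewrite mulrC mulrBr e subrr.
apply: fps_ext => n; elim/ltn_ind: n => n IH.
have := congr1 (fun A : fps R => A n) e.
by rewrite fps_mul_low // P0 mulr1.
Qed.

Section Powers.
Variable K : numFieldType.
Implicit Types (mu nu c : K) (G H : fps {poly K}) (A B F : fps K).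

Lemma fps_binom_rec mu n :
  fps_binom mu n.+1 *+ n.+1 + fps_binom mu n *+ n = mu * fps_binom mu n.
Proof.
rewrite /= big_ord_recr /= factS natrM invfM.
set p := \prod_(_ < _) _; set f := n`!%:R^-1.
rewrite -(mulr_natr (p * _ * _)) -(mulr_natr (p * f)).
have n0 : n.+1%:R != 0 :> K by rewrite pnatr_eq0.
have -> : p * (mu - n%:R) * (n.+1%:R^-1 * f) * n.+1%:R = p * (mu - n%:R) * f.
  by field; rewrite nat1r.
by ring.
Qed.

Let char0 n : n.+1%:R != 0 :> {poly K}.
Proof. by rewrite -polyC_natr polyC_eq0 pnatr_eq0. Qed.

Lemma fps_ppow0 G mu : fps_ppow G mu 0%N = 1.
Proof. by rewrite fps_comp0 /= big_ord0 fact0 divr1. Qed.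

Lemma fps_ppowP G mu : G 0%N = 1 ->
  G * fps_theta (fps_ppow G mu) = mu%:P *: (fps_theta G * fps_ppow G mu).
Proof.
move=> G0; apply: fps_comp_power_eq => // n.
by rewrite -!polyCMn -polyCD -polyCM fps_binom_rec.
Qed.

(** Every law of exponents below is obtained by checking that the proposed
    product solves this equation. *)
Lemma fps_ppow_uniq G H mu : G 0%N = 1 -> H 0%N = 1 ->
  G * fps_theta H = mu%:P *: (fps_theta G * H) -> H = fps_ppow G mu.
Proof.
move=> G0 H0 eH; apply: fps_power_uniq char0 G0 _ eH (fps_ppowP _ G0).
by rewrite fps_ppow0.
Qed.

Lemma fps_ppowD G mu nu : G 0%N = 1 ->
  fps_ppow G (mu + nu) = fps_ppow G mu * fps_ppow G nu.
Proof.
move=> G0; apply/esym/fps_ppow_uniq => //.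
  exact: fps_mul01 (fps_ppow0 _ _) (fps_ppow0 _ _).
rewrite fps_thetaM mulrDr mulrA fps_ppowP // mulrCA fps_ppowP // polyCD.
by rewrite -scalerAl -scalerAr scalerDl; congr (_ *: _ + _ *: _); ring.
Qed.

Lemma fps_ppowM G H mu : G 0%N = 1 -> H 0%N = 1 ->
  fps_ppow (G * H) mu = fps_ppow G mu * fps_ppow H mu.
Proof.
move=> G0 H0; apply/esym/fps_ppow_uniq.
- exact: fps_mul01.
- exact: fps_mul01 (fps_ppow0 _ _) (fps_ppow0 _ _).
have := fps_ppowP mu G0; have := fps_ppowP mu H0; rewrite !fps_thetaM.
move: (fps_ppow G mu) (fps_ppow H mu) => P Q eQ eP.
rewrite (_ : G * H * _ = (G * fps_theta P) * (H * Q) + (G * P) * (H * fps_theta Q)).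
  by rewrite eP eQ -scalerAl -scalerAr -scalerDr; congr (_ *: _); ring.
by ring.
Qed.

Lemma fps_ppow1 G : G 0%N = 1 -> fps_ppow G 1 = G.
Proof.
by move=> G0; apply/esym/fps_ppow_uniq => //; rewrite scale1r mulrC.
Qed.

Lemma fps_ppow_mulr G mu nu : G 0%N = 1 ->
  fps_ppow (fps_ppow G mu) nu = fps_ppow G (mu * nu).
Proof.
move=> G0; apply: fps_ppow_uniq => //; first exact: fps_ppow0.
have P0 := fps_ppow0 G mu; have := fps_ppowP nu P0; have := fps_ppowP mu G0.
set P := fps_ppow G mu; set Q := fps_ppow P nu => eP eQ.
apply: (fps_mulI P0).
rewrite mulrCA eQ -scalerAr mulrA eP -scalerAl scalerA -polyCM mulrC.
by rewrite -scalerAr mulrCA -mulrA mulrC; congr (_ *: _); ring.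
Qed.

Lemma fps_ppowX G mu k : G 0%N = 1 -> fps_ppow G mu ^+ k = fps_ppow G (mu *+ k).
Proof.
move=> G0; elim: k => [|k IH]; last by rewrite exprS mulrS fps_ppowD // IH.
rewrite expr0; apply: fps_ppow_uniq => //.
have -> : fps_theta (1 : fps {poly K}) = 0.
  by apply: fps_ext => -[|n]; rewrite fps_thetaE fps1E ?mulr0n ?mul0rn.
by rewrite mulr0 scale0r.
Qed.

Lemma fps_polyC_pow A mu :
  fps_polyC (fps_pow A mu) = fps_ppow (fps_polyC A) mu.
Proof. by rewrite fps_polyC_comp rmorphB rmorph1. Qed.

Lemma fps_pow0 A mu : fps_pow A mu 0%N = 1.
Proof. by rewrite fps_comp0 /= big_ord0 fact0 divr1. Qed.

Let polyC_coef0 A : A 0%N = 1 -> fps_polyC A 0%N = 1.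
Proof. by move=> A0 /=; rewrite A0 polyC1. Qed.

Lemma fps_powD A mu nu : A 0%N = 1 ->
  fps_pow A (mu + nu) = fps_pow A mu * fps_pow A nu.
Proof.
move=> A0; apply: fps_polyC_inj; rewrite rmorphM /= !fps_polyC_pow.
by rewrite fps_ppowD ?polyC_coef0.
Qed.

Lemma fps_powX A mu k : A 0%N = 1 -> fps_pow A mu ^+ k = fps_pow A (mu *+ k).
Proof.
move=> A0; apply: fps_polyC_inj; rewrite rmorphXn /= !fps_polyC_pow.
by rewrite fps_ppowX ?polyC_coef0.
Qed.

Lemma fps_pow1 A : A 0%N = 1 -> fps_pow A 1 = A.
Proof.
by move=> A0; apply: fps_polyC_inj; rewrite fps_polyC_pow fps_ppow1 ?polyC_coef0.
Qed.

Lemma fps_pow_lin c mu n :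
  fps_pow (1 - c *: 't) (- mu) n = c ^+ n * (poch mu n / n`!%:R).
Proof.
rewrite /fps_pow addrAC subrr add0r -scaleNr fps_comp_scale_t /= !mulrA.
congr (_ / _); rewrite /poch; elim: n => [|n IH]; first by rewrite !big_ord0.
rewrite !big_ord_recr /= !exprSr.
move: IH; set p := \prod_(_ < _) _; set q := \prod_(_ < _) _ => IH.
transitivity ((- c) ^+ n * p * (c * (mu + n%:R))); first by ring.
by rewrite IH; ring.
Qed.

(** All the generating functions below are brought to this shape: around [x0]
    the argument of [F] is a monomial in [x - x0], so that the expansion at
    [x0] needs only the powers of [B]. *)
Lemma gf_expansion A B F (x0 : K) n :
  (fps_polyC A
    * fps_comp (fps_polyC F) (('X - x0%:P) *: ('t * fps_polyC B))) n
  = \sum_(k < n.+1) (F k * (A * B ^+ k) (n - k)%N) *: ('X - x0%:P) ^+ k.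
Proof.
rewrite fps_mul_comp; last by rewrite fpsZE fps_mul0 mul0r mulr0.
apply: eq_bigr => k _; rewrite exprZn exprMn -scalerAr fpsZE.
rewrite (mulrCA (fps_polyC A)) fps_mul_tX -ltnS ltn_ord -rmorphXn -rmorphM /=.
by rewrite mulrCA -polyCM mulrC mul_polyC.
Qed.
End Powers.

(** * The Jacobi polynomials *)

(** Proof by certificate: when [u = v] is a multiple or a combination of known
    equations, the goal [a = b] is left to [ring] or [field]. *)
Lemma eq_from_diff (V : zmodType) (a b u v : V) : u = v -> a - b = u - v -> a = b.
Proof. by move=> ->; rewrite subrr => /eqP; rewrite subr_eq0 => /eqP. Qed.

Section Jacobi.
Variable K : numFieldType.
Implicit Types (alpha beta s dl : K) (p q : {poly K}).

Lemma pochS (mu : K) m : poch mu m.+1 = mu * poch (mu + 1) m.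
Proof. by rewrite -add1n pochD /poch big_ord1 addr0. Qed.

Lemma poch_neg n k : poch (- n%:R) k = (-1) ^+ k * (n ^_ k)%:R :> K.
Proof.
elim: k => [|k IH]; first by rewrite /poch big_ord0 expr0 mul1r.
rewrite /poch big_ord_recr /= -/(poch _ _) IH exprSr ffactnSr natrM.
case: (leqP k n) => kn; first by rewrite natrB //; ring.
by rewrite ffact_small // mulr0 !mul0r mulr0.
Qed.

Definition admissible s := forall m : nat, s != - m.+2%:R.

Lemma admissible_neq0 s m : admissible s -> s + m.+2%:R != 0.
Proof. by move=> adm; rewrite addr_eq0. Qed.

(** Every factor is [s] plus an integer that is at least 2, as [m] is positive
    whenever there is a factor. *)
Lemma poch_admissible s n k m : admissible s -> (n = k + m)%N ->
  poch (n%:R + k%:R + s + 1) m != 0.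
Proof.
move=> adm ->; apply/prodf_neq0 => i _.
have [m0 im] : (0 < m)%N /\ (i < m)%N by rewrite (leq_trans _ (ltn_ord i)).
have := admissible_neq0 (k + m + k + i).-1 adm.
have -> : ((k + m + k + i).-1.+2 = k + m + k + 1 + i)%N.
  by rewrite prednK ?addn_gt0 ?m0 ?orbT // -addn1 addnAC.
congr (_ != 0); rewrite !natrD; ring.
Qed.

(** The Taylor coefficients of [jacobi alpha beta n] at [1]. In this form no
    Pochhammer symbol of [alpha + 1] has to be inverted, so negative integers
    [alpha] are included. *)
Definition jacobi_taylor alpha beta n k : K :=
  2 ^+ (n - k) * 'C(n, k)%:R * poch (alpha + 1 + k%:R) (n - k)
    / poch (n%:R + k%:R + (alpha + beta) + 1) (n - k).

Section FixedParameters.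
Variables alpha beta : K.
Hypothesis adm : admissible (alpha + beta).

Lemma jacobi_taylorE n :
  jacobi alpha beta n
  = \sum_(k < n.+1) jacobi_taylor alpha beta n k *: ('X - 1) ^+ k.
Proof.
rewrite /jacobi scaler_sumr; apply: eq_bigr => k _.
have kn : (k <= n)%N by rewrite -ltnS ltn_ord.
have -> : 2^-1 *: (1 - 'X) = (- 2^-1) *: ('X - 1) :> {poly K}.
  by rewrite scaleNr -scalerN opprB.
rewrite exprZn !scalerA; congr (_ *: _).
have nz := poch_admissible adm (esym (subnKC kn)).
have nz0 := poch_admissible adm (esym (add0n n)).
have e : poch (n%:R + alpha + beta + 1) n
       = poch (n%:R + alpha + beta + 1) k
         * poch (n%:R + k%:R + (alpha + beta) + 1) (n - k).
  by rewrite -{2}(subnKC kn) pochD; congr (_ * poch _ _); ring.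
move: nz0; rewrite addr0 addrA e mulf_eq0 negb_or => /andP[nzk _].
rewrite poch_neg -bin_ffact natrM /jacobi_taylor.
have k0 : k`!%:R != 0 :> K by rewrite pnatr_eq0 -lt0n fact_gt0.
rewrite -{1}(subnKC kn) exprD -[- 2^-1]mulN1r exprMn exprVn.
have s1 : (-1) ^+ k * (-1) ^+ k = 1 :> K by rewrite -exprMn mulrNN mulr1 expr1n.
have two0 : 2 ^+ k != 0 :> K by rewrite expf_neq0 // pnatr_eq0.
move: nz nzk k0 s1 two0; set a := poch _ (n - k); set b := poch _ k.
set c := poch _ (n - k); set f := k`!%:R; set e1 := (-1) ^+ k.
set t := 2 ^+ k; set u := 2 ^+ _; set v := 'C(_, _)%:R.
move: a b c f e1 t u v => a b c f e1 t u v a0 b0 f0 s1 t0.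
transitivity (u * v * c / a * (e1 * e1)); last by rewrite s1 mulr1.
by field; rewrite a0 b0 f0 t0.
Qed.

Let D n := \poly_(k < n.+1) jacobi_taylor alpha beta n k.

Let jacobi_comp n : jacobi alpha beta n = D n \Po ('X - 1).
Proof.
rewrite jacobi_taylorE /D poly_def rmorph_sum /=; apply: eq_bigr => k _.
by rewrite comp_polyZ rmorphXn /= comp_polyX.
Qed.

Lemma jacobi_taylor_nn n : jacobi_taylor alpha beta n n = 1.
Proof. by rewrite /jacobi_taylor subnn binn expr0 /poch !big_ord0 !mulr1 divr1. Qed.

Lemma jacobi_mps : is_mps (jacobi alpha beta).
Proof.
move=> n; have szD : size (D n) = n.+1.
  by rewrite size_poly_eq // jacobi_taylor_nn oner_eq0.
have X1 : size ('X - 1 : {poly K}) = 2 by rewrite -polyC1 size_XsubC.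
rewrite jacobi_comp size_comp_poly2 // szD; split=> //.
apply/monicP; rewrite lead_coef_comp ?X1 // szD -polyC1 lead_coefXsubC expr1n.
by rewrite mulr1 lead_coefE szD coef_poly ltnSn jacobi_taylor_nn.
Qed.

(** The hypergeometric equation in the variable [x - 1]. *)
Let jacobi_taylor_rec n k :
  (n%:R - k%:R) * (n%:R + k%:R + (alpha + beta) + 1) * (D n)`_k
  = 2 * k.+1%:R * (k%:R + 1 + alpha) * (D n)`_k.+1.
Proof.
case: (ltngtP k n) => [kn|nk|->]; first last.
- by rewrite [in RHS]coef_poly ltnn subrr !mul0r mulr0.
- by rewrite !coef_poly !ltnS leqNgt nk ltnNge (ltnW nk) /= !mulr0.
rewrite !coef_poly ltnS (ltnW kn) ltnS kn /jacobi_taylor.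
have -> : (n - k = (n - k.+1).+1)%N by rewrite subnSK.
have nz := poch_admissible adm (esym (subnKC (ltnW kn))).
move: nz; rewrite -{1}subnSK // !pochS.
have -> : n%:R + k%:R + (alpha + beta) + 1 + 1
          = n%:R + k.+1%:R + (alpha + beta) + 1 by rewrite -natr1; ring.
have -> : alpha + 1 + k%:R + 1 = alpha + 1 + k.+1%:R by rewrite -natr1; ring.
have : k.+1%:R * 'C(n, k.+1)%:R = (n%:R - k%:R) * 'C(n, k)%:R :> K.
  by rewrite -natrM mul_bin_left natrM natrB // ltnW.
rewrite exprS; move: (n - k.+1)%N => m.
move: (poch _ m) (poch _ m) => a b.
set x := n%:R + k%:R + _ + 1; move: x 'C(_, _)%:R 'C(_, _)%:R (2 ^+ m) => x c0 c1 t e.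
rewrite mulf_eq0 negb_or => /andP[x0 b0].
transitivity (2 * t * (alpha + 1 + k%:R) * a / b * ((n%:R - k%:R) * c0)).
  by field; rewrite x0 b0.
by rewrite -e; field.
Qed.

(** The differential equation
    [(1 - x^2) y'' + (beta - alpha - (alpha + beta + 2) x) y'
       + n (n + alpha + beta + 1) y = 0]
    read off coefficient by coefficient. *)
Lemma jacobi_coef_rec n k :
  (n%:R - k%:R) * (n%:R + k%:R + (alpha + beta) + 1) * (jacobi alpha beta n)`_k
  = (alpha - beta) * k.+1%:R * (jacobi alpha beta n)`_k.+1
    - k.+2%:R * k.+1%:R * (jacobi alpha beta n)`_k.+2.
Proof.
set c := n%:R * (n%:R + (alpha + beta) + 1).
have odeD : 'X * ('X * (D n)^`()^`()) + ('X * (D n)^`()^`()) *+ 2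
    + (2 * (alpha + 1)) *: (D n)^`() + (alpha + beta + 2) *: ('X * (D n)^`())
    = c *: D n.
  apply/polyP => i; apply: (eq_from_diff (esym (jacobi_taylor_rec n i))).
  rewrite !coefD !coefZ !coefXM !coef_deriv.
  by case: i => [|[|i]] /=; rewrite /c; ring.
set y := jacobi alpha beta n.
have ode : y^`()^`() - 'X * ('X * y^`()^`())
    + (beta - alpha) *: y^`() - (alpha + beta + 2) *: ('X * y^`()) + c *: y = 0.
  have q' : ('X - 1 : {poly K})^`() = 1 by rewrite derivB derivX -polyC1 derivC subr0.
  rewrite /y jacobi_comp !(deriv_comp, q', mulr1).
  have := congr1 (fun p => p \Po ('X - 1)) odeD.
  rewrite !comp_polyD !comp_polyZ !comp_polyM !comp_polyX.
  move: (D n \Po _) ((D n)^`() \Po _) ((D n)^`()^`() \Po _) => u u' u'' <-.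
  by rewrite -!mul_polyC; ring.
move: y ode => y ode; apply: (eq_from_diff (congr1 (coefp k) ode)).
rewrite /coefp !coefD !coefN !coefZ !coefXM !coef_deriv coef0.
by case: k => [|[|k]] /=; rewrite /c; ring.
Qed.
End FixedParameters.

Lemma coef_comp_polyN p k : (p \Po - 'X)`_k = (-1) ^+ k * p`_k.
Proof.
elim/poly_ind: p k => [|p c IH] k; first by rewrite comp_poly0 coef0 mulr0.
rewrite comp_poly_MXaddC mulrN coefD coefN coefMX coefD coefMX !coefC IH.
case: k => [|k] /=; first by rewrite expr0 mul1r oppr0.
by rewrite !addr0 exprS mulN1r mulNr.
Qed.

(** The recurrence runs down from the leading coefficient; admissibility is
    what keeps its left factor nonzero on the way. *)
Lemma jacobi_rec_uniq s dl n p q : admissible s ->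
  (size p <= n.+1)%N -> (size q <= n.+1)%N -> p`_n = q`_n ->
  (forall k, (n%:R - k%:R) * (n%:R + k%:R + s + 1) * p`_k
     = dl * k.+1%:R * p`_k.+1 - k.+2%:R * k.+1%:R * p`_k.+2) ->
  (forall k, (n%:R - k%:R) * (n%:R + k%:R + s + 1) * q`_k
     = dl * k.+1%:R * q`_k.+1 - k.+2%:R * k.+1%:R * q`_k.+2) ->
  p = q.
Proof.
move=> adm sp sq pq rp rq.
suff E d k : (n <= k + d)%N -> p`_k = q`_k.
  by apply/polyP => k; apply: (E n); rewrite leq_addl.
elim/ltn_ind: d k => d IH k nkd; case: (ltngtP n k) => [nk|kn|<-] //.
  by rewrite !nth_default // (leq_trans _ nk).
case: d IH nkd => [|d] IH nkd; first by rewrite addn0 leqNgt kn in nkd.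
have nz : (n%:R - k%:R) * (n%:R + k%:R + s + 1) != 0.
  rewrite mulf_neq0 ?subr_eq0 ?eqr_nat ?gtn_eqF //.
  have := admissible_neq0 (n + k).-1 adm; congr (_ != 0).
  have -> : ((n + k).-1.+2 = n + k + 1)%N.
    by rewrite addn1 prednK // addn_gt0 (leq_ltn_trans _ kn).
  by rewrite !natrD; ring.
rewrite -addSnnS in nkd.
by apply: (mulfI nz); rewrite rp rq !(IH d) // addSn leqW.
Qed.

(** The substitution [x := - x] exchanges [alpha] and [beta] in the
    differential equation, whose monic solution of degree [n] is unique. *)
Lemma jacobi_reflect alpha beta n : admissible (alpha + beta) ->
  jacobi alpha beta n \Po - 'X = (-1) ^+ n *: jacobi beta alpha n.
Proof.
move=> adm; have adm' : admissible (beta + alpha) by rewrite addrC.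
have [/monicP lcP szP] := jacobi_mps adm n.
have [/monicP lcQ szQ] := jacobi_mps adm' n.
have sN : (-1) ^+ n * (-1) ^+ n = 1 :> K by rewrite -exprMn mulrNN mulr1 expr1n.
suff <- : (-1) ^+ n *: (jacobi alpha beta n \Po - 'X) = jacobi beta alpha n.
  by rewrite scalerA sN scale1r.
apply: (jacobi_rec_uniq adm' _ _ _ _ (jacobi_coef_rec adm' n)).
- rewrite (leq_trans (size_scale_leq _ _)) // size_comp_poly2 ?szP //.
  by rewrite size_polyN size_polyX.
- by rewrite szQ.
- rewrite coefZ coef_comp_polyN mulrA sN mul1r.
  by move: lcP lcQ; rewrite !lead_coefE szP szQ /= => -> ->.
move=> k; rewrite !coefZ !coef_comp_polyN.
have := jacobi_coef_rec adm n k; rewrite !exprS (addrC beta).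
set a := _`_k; set b := _`_k.+1; set c := _`_k.+2; set u := (-1) ^+ k.
set v := (-1) ^+ n; move: a b c u v => a b c u v e.
by apply: (eq_from_diff (congr1 ( *%R (u * v)) e)); ring.
Qed.
End Jacobi.

(** * Rescaling and reflection *)

Section Twist.
Variable K : numFieldType.
Implicit Types (d c : K) (A F R : fps K) (U : fps {poly K}).

(** The substitution [t := d t] combined with a ring endomorphism [f] acting on
    the coefficients; rescaling takes [f] to be the identity and reflection
    takes [f] to be the substitution [x := - x]. *)
Definition fps_twist d (f : {poly K} -> {poly K}) U : fps {poly K} :=
  Fps (fun n => (d ^+ n)%:P * f (U n)).

Section Endomorphism.
Variables (d : K) (f : {rmorphism {poly K} -> {poly K}}).
Hypothesis fC : forall a, f a%:P = a%:P.

Lemma fps_twist_is_zmod_morphism : zmod_morphism (fps_twist d f).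
Proof. by move=> U V; apply: fps_ext => n /=; rewrite rmorphB mulrBr. Qed.

Lemma fps_twist_is_monoid_morphism : monoid_morphism (fps_twist d f).
Proof.
split=> [|U V]; apply: fps_ext => n /=.
  by rewrite rmorph_nat; case: n => [|n]; rewrite ?expr0 ?mul1r ?mulr0.
rewrite rmorph_sum mulr_sumr; apply: eq_bigr => i _.
have -> : d ^+ n = d ^+ i * d ^+ (n - i) by rewrite -exprD subnKC // -ltnS.
by rewrite !rmorphM mulrACA.
Qed.

HB.instance Definition _ := GRing.isZmodMorphism.Build (fps {poly K})
  (fps {poly K}) (fps_twist d f) fps_twist_is_zmod_morphism.
HB.instance Definition _ := GRing.isMonoidMorphism.Build (fps {poly K})
  (fps {poly K}) (fps_twist d f) fps_twist_is_monoid_morphism.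

Lemma fps_twist_comp F U :
  fps_twist d f (fps_comp (fps_polyC F) U)
  = fps_comp (fps_polyC F) (fps_twist d f U).
Proof.
apply: fps_ext => n; rewrite /= rmorph_sum mulr_sumr; apply: eq_bigr => k _.
by rewrite -rmorphXn /= rmorphM fC mulrCA.
Qed.

Lemma fps_twist_polyC A :
  fps_twist d f (fps_polyC A) = fps_polyC (fps_comp A (d *: 't)).
Proof.
apply: fps_ext => n.
by rewrite -[RHS]/((fps_comp A (d *: 't) n)%:P) fps_comp_scale_t polyCM /= fC.
Qed.

Lemma fps_twistZ p U : fps_twist d f (p *: U) = f p *: fps_twist d f U.
Proof. by apply: fps_ext => n /=; rewrite rmorphM mulrCA. Qed.

Lemma fps_twist_t : fps_twist d f 't = d%:P *: 't.
Proof.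
apply: fps_ext => n /=; rewrite rmorph_nat.
by case: n => [|[|n]] //=; rewrite ?mulr0.
Qed.

Lemma gf_identity_twist (P : nat -> {poly K}) (a : nat -> K) A R F :
  fps_polyC A
    * fps_comp (fps_polyC F) ('X *: ('t * fps_polyC A) - fps_polyC R)
  = Fps (fun n => a n *: P n) ->
  let A' := fps_polyC (fps_comp A (d *: 't)) in
  A' * fps_comp (fps_polyC F)
         ((f 'X * d%:P) *: ('t * A') - fps_polyC (fps_comp R (d *: 't)))
  = Fps (fun n => (d ^+ n * a n) *: f (P n)).
Proof.
move=> /(congr1 (fps_twist d f)).
rewrite rmorphM /= fps_twist_comp rmorphB /= fps_twistZ rmorphM /= !fps_twist_polyC.
rewrite fps_twist_t -scalerAl scalerA => ->; apply: fps_ext => n /=.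
by rewrite -mul_polyC rmorphM fC mulrA -polyCM mul_polyC.
Qed.
End Endomorphism.

Lemma gf_rescaleP (P : nat -> {poly K}) D c :
  c != 0 -> is_gf P D -> is_gf P (gf_rescale c D).
Proof.
move=> c0 gfD; have [mps a0 a1 FE A0 R0 e] := gfD.
split=> //=.
- by move=> n; rewrite mulf_neq0 // expf_neq0.
- by rewrite a1 mulr1.
- by rewrite FE; apply: fps_ext => n; rewrite fps_comp_scale_t.
- by rewrite big_ord1 expr0 mulr1.
- by rewrite big_ord1 R0 mul0r mulr0.
have := gf_identity_twist c (f := idfun) (fun=> erefl) e.
set A' := fps_polyC (fps_comp (gf_A D) (c *: 't)).
set R' := fps_comp (gf_R D) (c *: 't) => e'.
rewrite -{}e' [in LHS]fps_polyC_comp fps_polyCZ fps_polyC_t.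
move: A' R' => A' R'.
rewrite (fps_comp_comp_scale c%:P (fps_polyC (gf_F D))) scalerBr fps_polyCZ !scalerA.
by rewrite -polyCM (mulfV c0) scale1r (mulrC c%:P).
Qed.

Lemma jacobi_gf_reflect (alpha beta : K) D : admissible (alpha + beta) ->
  is_gf (jacobi alpha beta) D -> is_gf (jacobi beta alpha) (gf_reflect D).
Proof.
move=> adm gfD; have [_ a0 a1 FE A0 R0 e] := gfD.
split=> //=.
- by apply: jacobi_mps; rewrite addrC.
- by rewrite big_ord1 expr0 mulr1.
- by rewrite big_ord1 R0 mul0r.
have := gf_identity_twist (- 1) (f := comp_poly (- 'X)) (@comp_polyC _ ^~ _) e.
rewrite scaleN1r /= comp_polyX polyCN mulrNN mulr1 => ->; apply: fps_ext => n /=.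
rewrite jacobi_reflect // scalerA; congr (_ *: _).
by rewrite mulrAC -exprMn mulrNN mulr1 expr1n mul1r.
Qed.
End Twist.

(** * The listed generating functions *)

Section Listed.
Variable K : numFieldType.
Implicit Types (alpha beta lam mu x c : K) (A F U : fps K).

(** The duplication formula: it lets the two Pochhammer symbols of the Taylor
    coefficients of a Jacobi polynomial meet the single one produced by a power
    of [1 - c t]. *)
Lemma poch_dup x m :
  poch x (m + m) = 4 ^+ m * poch (x / 2) m * poch ((x + 1) / 2) m.
Proof.
elim: m => [|m IH]; first by rewrite /poch !big_ord0 expr0 !mulr1.
rewrite addnS addSn /poch !big_ord_recr /= -!/(poch _ _) IH exprSr.
by field.
Qed.

Lemma poch_neq0 x j : (forall i : nat, x != - i%:R) -> poch x j != 0.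
Proof. by move=> x0; apply/prodf_neq0 => i _; rewrite addr_eq0. Qed.

Lemma poch_fact k m : poch (k%:R + 1 : K) m * k`!%:R = (k + m)`!%:R.
Proof.
elim: m => [|m IH]; first by rewrite /poch big_ord0 mul1r addn0.
rewrite addnS factS natrM -IH /poch big_ord_recr /= -natr1 natrD; ring.
Qed.

Lemma bin_fact_div k m :
  'C(k + m, k)%:R = (k + m)`!%:R / (k`!%:R * m`!%:R) :> K.
Proof.
have nz j : j`!%:R != 0 :> K by rewrite pnatr_eq0 -lt0n fact_gt0.
rewrite -(bin_fact (leq_addr m k)) addKn !natrM.
by move: (nz k) (nz m); move: 'C(_, _)%:R => b k0 m0; field; rewrite k0 m0.
Qed.

Lemma fps_powVn A k : A 0%N = 1 -> fps_pow A (- k%:R) * A ^+ k = 1.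
Proof.
move=> A0; rewrite -{2}(fps_pow1 A0) fps_powX // -fps_powD // addNr.
by rewrite -(mulr0n 0) -fps_powX ?expr0.
Qed.

Lemma fps_comp_pow_1B_t mu (V : fps {poly K}) :
  fps_comp (fps_polyC (fps_pow (1 - 't) mu)) V = fps_ppow (1 - V) mu.
Proof.
rewrite /fps_pow; have -> : 1 - 't - 1 = -1 *: 't :> fps K.
  by rewrite addrAC subrr add0r scaleN1r.
rewrite /fps_ppow addrAC subrr add0r fps_polyC_comp fps_polyCZ fps_polyC_t.
by rewrite fps_comp_comp_scale polyCN scaleN1r.
Qed.

(** The exponents of [A] and [B] are chosen so that [A B^k] is again a power
    of [1 - c t]; with [mu = 2] this is [B F((x - x0) t B)]. *)
Lemma gf_expansion_lin c mu F (x0 : K) n :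
  (fps_polyC (fps_pow (1 - c *: 't) (- mu))
    * fps_comp (fps_polyC F)
        (('X - x0%:P) *: ('t * fps_polyC (fps_pow (1 - c *: 't) (- 2))))) n
  = \sum_(k < n.+1) (F k * (c ^+ (n - k) * (poch (mu + k.*2%:R) (n - k)
                                           / (n - k)`!%:R)))
        *: ('X - x0%:P) ^+ k.
Proof.
have T0 : (1 - c *: 't : fps K) 0%N = 1 by rewrite fpsBE fpsZE mulr0 subr0.
rewrite gf_expansion; apply: eq_bigr => k _; congr (_ * _ *: _).
rewrite fps_powX // -fps_powD // -fps_pow_lin; congr (fps_pow _ _ _).
by rewrite -mul2n natrM mulNrn opprD mulr_natr.
Qed.

(** ** The case [beta = alpha + 1] *)

Lemma jacobi_taylor_case1 alpha k m : admissible (alpha + (alpha + 1)) ->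
  poch (alpha + 3 / 2) (k + m) / (k + m)`!%:R
    * jacobi_taylor alpha (alpha + 1) (k + m) k
  = poch (alpha + 3 / 2) k / k`!%:R
    * (2^-1 ^+ m * (poch (2 * alpha + 2 + k.*2%:R) m / m`!%:R)).
Proof.
move=> adm; rewrite /jacobi_taylor addKn bin_fact_div pochD.
have := poch_admissible adm (erefl (k + m)%N).
have := poch_dup (2 * alpha + 2 + k.*2%:R) m; rewrite pochD.
have -> : (2 * alpha + 2 + k.*2%:R) / 2 = alpha + 1 + k%:R.
  by rewrite -mul2n natrM; field.
have -> : (2 * alpha + 2 + k.*2%:R + 1) / 2 = alpha + 3 / 2 + k%:R.
  by rewrite -mul2n natrM; field.
have -> : (k + m)%:R + k%:R + (alpha + (alpha + 1)) + 1
        = 2 * alpha + 2 + k.*2%:R + m%:R.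
  by rewrite -mul2n natrM natrD; ring.
move: (poch _ m) (poch _ m) (poch _ m) (poch _ m) (poch _ k) => a b c d e.
have nz j : j`!%:R != 0 :> K by rewrite pnatr_eq0 -lt0n fact_gt0.
move: (nz (k + m)%N) (nz k) (nz m).
move: (_`!%:R) (_`!%:R) (_`!%:R) => f g h h0 g0 f0 E b0.
have -> : 2 ^+ m = 4 ^+ m * 2^-1 ^+ m :> K.
  by rewrite -exprMn; congr (_ ^+ m); field.
rewrite (canRL (mulfK b0) E); field.
by rewrite b0 f0 g0 h0.
Qed.

Lemma jacobi_taylor_case3 alpha k m : admissible (alpha + (1 - alpha)) ->
  (forall j : nat, alpha + 1 != - j%:R) ->
  poch (3 / 2) (k + m) / poch (alpha + 1) (k + m) * 2 ^+ (k + m)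
    * jacobi_taylor alpha (1 - alpha) (k + m) k
  = poch (3 / 2) k / poch (alpha + 1) k * 2 ^+ k
    * (1 ^+ m * (poch (2 + k.*2%:R) m / m`!%:R)).
Proof.
move=> adm c0; rewrite /jacobi_taylor addKn bin_fact_div !pochD expr1n mul1r.
have := poch_admissible adm (erefl (k + m)%N).
have := poch_dup (2 + k.*2%:R) m; rewrite pochD.
have -> : (2 + k.*2%:R) / 2 = k%:R + 1 :> K by rewrite -mul2n natrM; field.
have -> : (2 + k.*2%:R + 1) / 2 = 3 / 2 + k%:R :> K.
  by rewrite -mul2n natrM; field.
have -> : (k + m)%:R + k%:R + (alpha + (1 - alpha)) + 1 = 2 + k.*2%:R + m%:R.
  by rewrite -mul2n natrM natrD; ring.
have c0k i : alpha + 1 + k%:R != - i%:R.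
  by rewrite -addr_eq0 -addrA -natrD addr_eq0 c0.
rewrite -poch_fact; move: (poch_neq0 m c0k) (poch_neq0 k c0).
move: (poch _ m) (poch _ m) (poch _ m) (poch _ m) (poch _ m) => a b c d e.
have nz j : j`!%:R != 0 :> K by rewrite pnatr_eq0 -lt0n fact_gt0.
move: (nz k) (nz m) (poch _ k) (poch _ k).
have -> : 4 ^+ m = 2 ^+ m * 2 ^+ m :> K.
  by rewrite -exprMn; congr (_ ^+ m); ring.
rewrite exprD; move: (_`!%:R) (_`!%:R) => f g f0 g0 p q.
move=> e0 q0 E c0'; rewrite (canRL (mulfK c0') E); field.
by rewrite c0' e0 q0 f0 g0.
Qed.

(** Writing [1 - x t + t^2 / 4 = (1 - t / 2)^2 (1 - (x - 1) t (1 - t / 2)^-2)]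
    reduces the right-hand side to an expansion around [1]. *)
Lemma jacobi_genfun1 alpha : admissible (alpha + (alpha + 1)) ->
  Fps (fun n => (poch (alpha + 3 / 2) n / n`!%:R) *: jacobi alpha (alpha + 1) n)
  = (1 - (2^-1)%:P *: 't)
    * fps_ppow (1 - 'X *: 't + (4^-1)%:P *: 't ^+ 2) (- (alpha + 3 / 2)).
Proof.
move=> adm; set lam := alpha + 3 / 2; set T := 1 - 2^-1 *: 't : fps K.
have T0 : T 0%N = 1 by rewrite fpsBE fpsZE mulr0 subr0.
have pT : 1 - (2^-1)%:P *: 't = fps_polyC T.
  by rewrite rmorphB rmorph1 /= fps_polyCZ fps_polyC_t.
have pT0 : fps_polyC T 0%N = 1 by rewrite -[LHS]/((T 0%N)%:P) T0.
set V := ('X - 1%:P) *: ('t * fps_polyC (fps_pow T (- 2))).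
have V0 : (1 - V) 0%N = 1 by rewrite fpsBE fpsZE fps_mul0 mul0r mulr0 subr0.
have -> : 1 - 'X *: 't + (4^-1)%:P *: 't ^+ 2 = fps_polyC T ^+ 2 * (1 - V).
  have TB : fps_polyC T ^+ 2 * ('t * fps_polyC (fps_pow T (- 2))) = 't.
    rewrite mulrCA -rmorphXn -rmorphM mulrC.
    by rewrite [T ^+ 2 * _]mulrC (fps_powVn 2) // rmorph1 mul1r.
  rewrite mulrBr mulr1 /V -scalerAr TB scalerBl scale1r -pT.
  have -> : (4^-1)%:P *: 't ^+ 2 = ((2^-1)%:P *: 't) ^+ 2 :> fps {poly K}.
    by rewrite exprZn -rmorphXn; congr (_%:P *: _); field.
  have tt : 't = ((2^-1)%:P *: 't) *+ 2 :> fps {poly K}.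
    rewrite -scaler_nat scalerA -polyC_natr -polyCM mulfV ?scale1r //.
    by rewrite pnatr_eq0.
  by move: tt; move: ('X *: 't) ((2^-1)%:P *: 't) => w u ->; ring.
rewrite pT fps_ppowM //; last by rewrite fps_exp0 pT0 expr1n.
have TT : fps_polyC T * fps_ppow (fps_polyC T ^+ 2) (- lam)
    = fps_polyC (fps_pow T (- (2 * alpha + 2))).
  rewrite fps_polyC_pow -[in X in fps_ppow X _](fps_ppow1 pT0) fps_ppowX //.
  rewrite fps_ppow_mulr // -{1}(fps_ppow1 pT0) -fps_ppowD //; congr fps_ppow.
  by rewrite /lam; field.
rewrite mulrA TT -fps_comp_pow_1B_t; apply: fps_ext => n.
rewrite gf_expansion_lin [LHS]/= jacobi_taylorE // scaler_sumr.
apply: eq_bigr => k _; rewrite scalerA; congr (_ *: _).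
have kn : (k <= n)%N by rewrite -ltnS ltn_ord.
rewrite -{1 2 3}(subnKC kn) jacobi_taylor_case1 //; congr (_ * _).
by rewrite -['t]scale1r fps_pow_lin expr1n mul1r.
Qed.
(** With this [A] and [R], [1 - (x t A - R) = A (1 - x t + t^2 / 4)], so that
    [A F(x t A - R)] is [A^(1 - lam)] times a power of [1 - x t + t^2 / 4] for
    [lam = alpha + 3/2]; the exponent of [A] makes [A^(1 - lam)] equal to
    [1 - t / 2]. *)
Lemma jacobi_gf1P alpha : admissible (alpha + (alpha + 1)) ->
  alpha != - 2^-1 -> is_gf (jacobi alpha (alpha + 1)) (jacobi_gf1 alpha).
Proof.
move=> adm alpha12; set lam := alpha + 3 / 2; set T := 1 - 2^-1 *: 't : fps K.
have T0 : T 0%N = 1 by rewrite fpsBE fpsZE mulr0 subr0.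
have pT0 : fps_polyC T 0%N = 1 by rewrite -[LHS]/((T 0%N)%:P) T0.
split.
- exact: jacobi_mps.
- move=> n; rewrite mulf_neq0 ?invr_eq0 ?pnatr_eq0 -?lt0n ?fact_gt0 //.
  apply: poch_neq0 => i; have := adm i.*2; apply: contraNneq => e.
  have -> : alpha = - i%:R - 3 / 2 by rewrite -e; field.
  have -> : i.*2.+2%:R = 2 * i%:R + 2 :> K by rewrite -addn2 natrD -mul2n natrM.
  by apply/eqP; field.
- by rewrite /= /poch big_ord0 divr1.
- apply: fps_ext => n.
  by rewrite [gf_F _]/= -['t]scale1r fps_pow_lin expr1n mul1r.
- exact: fps_pow0.
- rewrite [gf_R _]/= fpsBE fps_mul0 (fps_pow0 T) fpsDE fpsZE expr2 fps_mul0.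
  by rewrite mul0r mulr0 addr0 mulr1 subrr.
apply: etrans (esym (jacobi_genfun1 adm)).
rewrite [gf_F _]/= [gf_A _]/= [gf_R _]/= -/T -/lam.
set nu := - (2 / (2 * alpha + 1)); set A := fps_pow T nu.
have A0 : fps_polyC A 0%N = 1 by rewrite fps_polyC_pow fps_ppow0.
set W := 1 - 'X *: 't + (4^-1)%:P *: 't ^+ 2.
have W0 : W 0%N = 1.
  by rewrite fpsDE fpsBE !fpsZE expr2 fps_mul0 mul0r !mulr0 subr0 addr0.
rewrite fps_comp_pow_1B_t.
have -> : 1 - ('X *: ('t * fps_polyC A)
               - fps_polyC ((1 + 4^-1 *: 't ^+ 2) * A - 1)) = fps_polyC A * W.
  rewrite rmorphB rmorphM rmorphD !rmorph1 /= fps_polyCZ rmorphXn /= fps_polyC_t.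
  rewrite /W mulrDr mulrBr mulr1 -scalerAr (mulrC 't).
  by move: (_ *: 't ^+ 2) (_ *: _) => u w; ring.
rewrite fps_ppowM // mulrA; congr (_ * _).
rewrite -{1}(fps_ppow1 A0) -fps_ppowD // fps_polyC_pow fps_ppow_mulr //.
have a12 : 2 * alpha + 1 != 0.
  by apply: contraNneq alpha12 => e; apply/eqP/(mulfI (_ : 2 != 0 :> K));
     rewrite ?pnatr_eq0 // -[LHS](addrK 1) e; field.
have -> : nu * (1 - lam) = 1 by rewrite /nu /lam; field.
by rewrite fps_ppow1 // rmorphB rmorph1 /= fps_polyCZ fps_polyC_t.
Qed.

(** ** The case [beta = 1 - alpha] *)

Lemma jacobi_expansion3 alpha n : admissible (alpha + (1 - alpha)) ->
  (forall j : nat, alpha + 1 != - j%:R) ->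
  (poch (3 / 2) n / poch (alpha + 1) n * 2 ^+ n) *: jacobi alpha (1 - alpha) n
  = \sum_(k < n.+1) (poch (3 / 2) k / poch (alpha + 1) k * 2 ^+ k
      * (1 ^+ (n - k) * (poch (2 + k.*2%:R) (n - k) / (n - k)`!%:R)))
        *: ('X - 1%:P) ^+ k.
Proof.
move=> adm c0; rewrite jacobi_taylorE // scaler_sumr.
apply: eq_bigr => k _; rewrite scalerA; congr (_ *: _).
have kn : (k <= n)%N by rewrite -ltnS ltn_ord.
by rewrite -{1 2 3 4}(subnKC kn) jacobi_taylor_case3.
Qed.

(** For [R0 = -1] the third parameter is the one that belongs to the
    reflected polynomials. *)
Lemma jacobi_c3P alpha (R0 : K) : R0 = 1 \/ R0 = -1 ->
  jacobi_c3 alpha R0 = (if R0 == 1 then alpha else 1 - alpha) + 1.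
Proof.
have N1 : (-1 == 1 :> K) = false by rewrite eqNr oner_eq0.
by case=> ->; rewrite ?eqxx ?N1 /jacobi_c3; field.
Qed.

(** For [R0 = 1] this is the Taylor expansion at [1]; for [R0 = -1] it is the
    expansion of [jacobi (1 - alpha) alpha] at [1] under [x := - x]. *)
Lemma jacobi_genfun3 alpha (R0 : K) : admissible (alpha + (1 - alpha)) ->
  R0 = 1 \/ R0 = -1 -> (forall m : nat, jacobi_c3 alpha R0 != - m%:R) ->
  Fps (fun n => (poch (3 / 2) n / poch (jacobi_c3 alpha R0) n * (2 / R0) ^+ n)
                  *: jacobi alpha (1 - alpha) n)
  = fps_polyC (fps_pow (1 - 't) (- 2))
    * fps_comp (fps_polyC (hyp2F1 (3 / 2) 1 (jacobi_c3 alpha R0)))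
        (((2 / R0) *: ('X - R0%:P)) *: ('t * fps_polyC (fps_pow (1 - 't) (- 2)))).
Proof.
move=> adm hR; rewrite (jacobi_c3P _ hR) => c0.
set c := _ + 1 in c0 *; set h := hyp2F1 _ _ _.
set A := fps_pow _ _.
have -> : ((2 / R0) *: ('X - R0%:P)) *: ('t * fps_polyC A)
        = (2 / R0)%:P *: (('X - R0%:P) *: ('t * fps_polyC A)).
  by rewrite scalerA mul_polyC.
rewrite -fps_comp_comp_scale -fps_polyC_t -fps_polyCZ -fps_polyC_comp fps_polyC_t.
have hE k : fps_comp h ((2 / R0) *: 't) k
          = poch (3 / 2) k / poch c k * (2 / R0) ^+ k.
  rewrite fps_comp_scale_t /= [RHS]mulrC -mulrA; congr (_ * (_ * _)).
  have := poch_fact 0 k; rewrite add0r mulr1 add0n => ->.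
  have k0 : k`!%:R != 0 :> K by rewrite pnatr_eq0 -lt0n fact_gt0.
  by rewrite mulrC invfM -mulrA mulVf ?mulr1.
have A1 : A = fps_pow (1 - 1 *: 't) (- 2) by rewrite scale1r.
apply: fps_ext => n; rewrite A1 gf_expansion_lin [LHS]/=.
under [RHS]eq_bigr => k _ do rewrite hE.
clearbody h; clear hE.
case: hR => R0E.
  have cE : c = alpha + 1 by rewrite /c R0E eqxx.
  by move: c0; rewrite cE R0E divr1 => c0; rewrite jacobi_expansion3.
have cE : c = (1 - alpha) + 1 by rewrite /c R0E eqNr oner_eq0.
move: c0; rewrite cE R0E => c0.
have {}adm : admissible (1 - alpha + (1 - (1 - alpha))) by rewrite subKr addrC.
have := congr1 (fun p => p \Po - 'X) (jacobi_expansion3 n adm c0).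
have N1 : (2 / -1 : K) = - 2 by rewrite invrN1 mulrN1.
rewrite comp_polyZ jacobi_reflect // subKr scalerA -(mulrA _ (2 ^+ n)) -exprMn N1.
rewrite mulrN1 => ->; rewrite rmorph_sum; apply: eq_bigr => k _.
rewrite /= comp_polyZ rmorphXn /= comp_polyB comp_polyX comp_polyC.
rewrite polyCN opprK -opprD -scaleN1r exprZn scalerA; congr (_ *: _).
by rewrite -[- 2]mulN1r exprMn; ring.
Qed.

(** Since [(1 - d t)^2 A = 1], the constant [1] can be absorbed in [A]. This is
    why [R] is a multiple of [t A] in the last two cases, and [x t A - R] a
    multiple of a translate of [x]. *)
Lemma fps_pow_quadratic d :
  let A := fps_pow (1 - d *: 't : fps K) (- 2) in
  (1 + d ^+ 2 *: 't ^+ 2) * A - 1 = (2 * d) *: ('t * A).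
Proof.
move=> A.
have T0 : (1 - d *: 't : fps K) 0%N = 1 by rewrite fpsBE fpsZE mulr0 subr0.
rewrite -[X in _ - X](fps_powVn 2 T0) -/A -exprZn -scalerA scaler_nat scalerAl.
by move: (d *: 't) A => u B; ring.
Qed.

Corollary fps_pow_quadratic1 :
  let A := fps_pow (1 - 't : fps K) (- 2) in
  (1 + 't ^+ 2) * A - 1 = 2 *: ('t * A).
Proof.
move=> A; have := fps_pow_quadratic 1.
by rewrite mulr1 expr1n !scale1r.
Qed.

Lemma jacobi_gf3P alpha (R0 : K) : admissible (alpha + (1 - alpha)) ->
  R0 = 1 \/ R0 = -1 -> (forall m : nat, jacobi_c3 alpha R0 != - m%:R) ->
  is_gf (jacobi alpha (1 - alpha)) (jacobi_gf3 alpha R0).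
Proof.
move=> adm hR c0; have R00 : R0 != 0 by case: hR => ->; rewrite ?oppr_eq0 oner_eq0.
have half_neq i : 3 / 2 != - i%:R :> K.
  rewrite -addr_eq0 (_ : _ + _ = (3 + 2 * i)%:R / 2).
    by rewrite mulf_eq0 invr_eq0 !pnatr_eq0.
  by rewrite natrD natrM; field.
have two_neq0 : 2 / R0 != 0 by rewrite mulf_neq0 ?invr_eq0 ?pnatr_eq0.
split.
- exact: jacobi_mps.
- move=> n; rewrite !mulf_neq0 ?invr_eq0 ?expf_neq0 //; exact: poch_neq0.
- by rewrite /= /poch !big_ord0 divr1 mulr1.
- apply: fps_ext => n; rewrite [gf_F _]/= fps_comp_scale_t /= [LHS]mulrC.
  congr (_ * _); have := poch_fact 0 n; rewrite add0r mulr1 add0n => ->.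
  have n0 : n`!%:R != 0 :> K by rewrite pnatr_eq0 -lt0n fact_gt0.
  by rewrite invfM mulrACA mulfV ?mulr1.
- exact: fps_pow0.
- rewrite [gf_R _]/= fpsBE !fpsZE fps_mul0 fps_pow0 fpsDE expr2 fps_mul0.
  by rewrite mul0r addr0 !mulr1 subrr.
apply: etrans (esym (jacobi_genfun3 adm hR c0)).
rewrite [gf_F _]/= [gf_A _]/= [gf_R _]/=.
set A := fps_pow _ _; set h := hyp2F1 _ _ _.
have -> : (R0 / 2) *: ((1 + 't ^+ 2) * A) - (R0 / 2)%:A = R0 *: ('t * A).
  by rewrite -scalerBr fps_pow_quadratic1 scalerA; congr (_ *: _); field.
clearbody A h; rewrite fps_polyC_comp fps_polyCZ fps_polyC_t.
rewrite fps_comp_comp_scale; congr (_ * fps_comp _ _).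
rewrite fps_polyCZ (rmorphM (@fps_polyC K)) /= fps_polyC_t -scalerBl scalerA.
by rewrite mul_polyC.
Qed.

Let adm01 : admissible (0 + 1 : K).
Proof. by move=> m; rewrite add0r -addr_eq0 nat1r pnatr_eq0. Qed.

(** The case [(0, 1)] is the case [beta = 1 - alpha], [R0 = -1] in another
    normalisation of [t]. *)
Lemma jacobi_gf2_rescale :
  jacobi_gf2 K = gf_rescale (- 2^-1) (jacobi_gf3 0 (-1)).
Proof.
have c3 : jacobi_c3 0 (-1) = 2 :> K by rewrite /jacobi_c3; field.
have AE : fps_comp (fps_pow (1 - 't) (- 2)) (- 2^-1 *: 't)
          = fps_pow (1 + 2^-1 *: 't) (- 2) :> fps K.
  have -> : 1 + 2^-1 *: 't = 1 - (- 2^-1) *: 't :> fps K by rewrite scaleNr opprK.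
  have lin1 n : fps_pow (1 - 't : fps K) (- 2) n = poch 2 n / n`!%:R.
    by rewrite -['t]scale1r fps_pow_lin expr1n mul1r.
  apply: fps_ext => n; rewrite [RHS]fps_pow_lin -lin1.
  by move: (fps_pow _ _) => A; rewrite fps_comp_scale_t.
have half0 : - 2^-1 != 0 :> K by rewrite oppr_eq0 invr_eq0 pnatr_eq0.
have two2 n : (- 2^-1) ^+ n * (2 / -1) ^+ n = 1 :> K.
  have -> : 2 / -1 = (- 2^-1)^-1 :> K by field.
  by rewrite -exprMn (mulfV half0) expr1n.
have scaleE (B : fps K) n : fps_comp B (- 2^-1 *: 't) n = (- 2^-1) ^+ n * B n.
  exact: fps_comp_scale_t.
have RE : (1 + 4^-1 *: 't ^+ 2) * fps_pow (1 + 2^-1 *: 't) (- 2) - 1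
    = (- 2^-1)^-1 *: fps_comp ((-1 / 2) *: ((1 + 't ^+ 2) * fps_pow (1 - 't) (- 2))
                               - (-1 / 2)%:A) (- 2^-1 *: 't) :> fps K.
  have -> : 4^-1 = (- 2^-1) ^+ 2 :> K by field.
  rewrite -scalerBr [in RHS]fps_pow_quadratic1.
  have quad := fps_pow_quadratic (- 2^-1); rewrite scaleNr opprK in quad.
  rewrite {}quad -AE; move: (fps_pow _ _) => A.
  apply: fps_ext => n; rewrite [LHS]fpsZE [RHS]fpsZE scaleE (fpsZE (-1 / 2)).
  rewrite (fpsZE 2); case: n => [|n]; rewrite 2!fps_mul_t; first by rewrite !mulr0.
  by rewrite scaleE exprS; field.
rewrite /jacobi_gf2 /gf_rescale /= c3 AE RE; congr GFData.
- apply/funext => n; rewrite mulrCA two2 mulr1; congr (_ / _).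
  have := poch_fact 1 n; rewrite mulr1 => <-; congr poch; exact: natr1.
- by apply: fps_ext => n; rewrite !fps_comp_scale_t mulrA two2 mul1r.
Qed.

Lemma jacobi_gf2P : is_gf (jacobi 0 1) (jacobi_gf2 K).
Proof.
rewrite jacobi_gf2_rescale; apply: gf_rescaleP.
  by rewrite oppr_eq0 invr_eq0 pnatr_eq0.
have := @jacobi_gf3P 0 (-1); rewrite subr0; apply => //; first by right.
move=> m; have -> : jacobi_c3 0 (-1) = 2 :> K by rewrite /jacobi_c3; field.
by rewrite -addr_eq0 -natrD pnatr_eq0.
Qed.

Lemma jacobi_genfun2 :
  Fps (fun n => (poch (3 / 2) n / n.+1`!%:R) *: jacobi 0 1 n)
  = fps_polyC (fps_pow (1 + 2^-1 *: 't) (- 2))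
    * fps_comp (fps_polyC (hyp2F1 (3 / 2) 1 2))
        (('X + 1) *: ('t * fps_polyC (fps_pow (1 + 2^-1 *: 't : fps K) (- 2)))).
Proof.
apply: etrans (esym (gf_identity jacobi_gf2P)) _.
rewrite [gf_F _]/= [gf_A _]/= [gf_R _]/=; congr (_ * fps_comp _ _).
have -> : 1 + 2^-1 *: 't = 1 - (- 2^-1) *: 't :> fps K by rewrite scaleNr opprK.
have -> : 4^-1 = (- 2^-1) ^+ 2 :> K by field.
rewrite fps_pow_quadratic.
have -> : 2 * - 2^-1 = -1 :> K by field.
rewrite fps_polyCZ (rmorphM (@fps_polyC K)) /= fps_polyC_t -scalerBl.
by rewrite polyCN opprK.
Qed.
End Listed.

(** * What a generating function imposes on its data *)

Section LowOrder.
Variable R : comNzRingType.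
Implicit Types (A B S T : fps R).

Lemma fps_coef1 A B : (A * B) 1%N = A 0%N * B 1%N + A 1%N * B 0%N.
Proof. by rewrite fpsME !big_ord_recr big_ord0 /= add0r. Qed.

Lemma fps_coef2 A B :
  (A * B) 2 = A 0%N * B 2 + A 1%N * B 1%N + A 2 * B 0%N.
Proof. by rewrite fpsME !big_ord_recr big_ord0 /= add0r. Qed.

Lemma fps_coef3 A B :
  (A * B) 3 = A 0%N * B 3 + A 1%N * B 2 + A 2 * B 1%N + A 3 * B 0%N.
Proof. by rewrite fpsME !big_ord_recr big_ord0 /= add0r. Qed.

(** [A^m - B^m] is [A - B] times a sum of [m] products, each of which has
    constant term 1. *)
Lemma fps_exp_sub_low A B d m : A 0%N = 1 -> B 0%N = 1 ->
  (forall k, (k < d)%N -> A k = B k) ->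
  (forall k, (k < d)%N -> (A ^+ m) k = (B ^+ m) k)
  /\ (A ^+ m - B ^+ m) d = (A d - B d) *+ m.
Proof.
move=> A0 B0 AB; have low k : (k <= d)%N ->
    (A ^+ m - B ^+ m) k = (A - B) k *+ m.
  move=> kd; rewrite subrXX fps_mul_low => [|i ik]; last first.
    by rewrite fpsBE AB ?subrr // (leq_trans ik).
  rewrite fps_coef_sum (eq_bigr (fun=> 1)) => [|i _].
    by rewrite sumr_const card_ord mulr_natr.
  by rewrite fps_mul0 !fps_exp0 A0 B0 !expr1n mulr1.
split=> [k kd|]; last by rewrite low.
apply/eqP; rewrite -subr_eq0 -fpsBE low ?(ltnW kd) // fpsBE AB // subrr.
by rewrite mul0rn.
Qed.

Lemma fps_exp_sub_low0 A B d i : A 0%N = 0 -> B 0%N = 0 ->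
  (forall k, (k < d)%N -> A k = B k) ->
  forall k, (k <= d)%N -> (A ^+ i.+2) k = (B ^+ i.+2) k.
Proof.
move=> A0 B0 AB k kd; apply/eqP; rewrite -subr_eq0 -fpsBE subrXX.
rewrite fps_mul_low => [|j jk]; last first.
  by rewrite fpsBE AB ?subrr // (leq_trans jk).
rewrite fps_coef_sum big1 ?mulr0 // => j _; rewrite fps_mul0 !fps_exp0 A0 B0.
by rewrite !expr0n; case: (val j) => [|l]; rewrite ?mulr0 ?subn0 // mul0r.
Qed.

(** The coefficient through which [A] and [R] enter the expansion of
    [A F(x t A - R)] in powers of [x] and [t]. *)
Definition mixed_coef A S j i d : R := (A ^+ j.+1 * (- S) ^+ i) d.

(** For [i >= 2] a change of [A] or [R] in degree [d] is multiplied by at least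
    one further factor [R], which has no constant term, and so does not show in
    degree [d]. *)
Lemma mixed_coef_sub A B S T d j : A 0%N = 1 -> B 0%N = 1 ->
  S 0%N = 0 -> T 0%N = 0 ->
  (forall k, (k < d)%N -> A k = B k) -> (forall k, (k < d)%N -> S k = T k) ->
  [/\ mixed_coef A S j 0 d - mixed_coef B T j 0 d = (A d - B d) *+ j.+1,
      mixed_coef A S j 1 d - mixed_coef B T j 1 d = T d - S d
    & forall i, mixed_coef A S j i.+2 d = mixed_coef B T j i.+2 d].
Proof.
move=> A0 B0 S0 T0 AB ST.
have -> : T d - S d = (- S) d - (- T) d by rewrite !fpsNE opprK addrC.
have {ST}ST k : (k < d)%N -> (- S) k = (- T) k by move=> kd; rewrite !fpsNE ST.
have {S0}S0 : (- S) 0%N = 0 by rewrite fpsNE S0 oppr0.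
have {T0}T0 : (- T) 0%N = 0 by rewrite fpsNE T0 oppr0.
rewrite /mixed_coef; move: (- S) (- T) S0 T0 ST => {S T} S T S0 T0 ST.
set m := j.+1; have [lowX topX] := fps_exp_sub_low m A0 B0 AB.
have split_mul (X Y U V : fps R) : X * U - Y * V = (X - Y) * U + (U - V) * Y.
  by ring.
have lowX' k : (k < d)%N -> (A ^+ m - B ^+ m) k = 0.
  by move=> kd; rewrite fpsBE (lowX _ kd) subrr.
have X0 : (B ^+ m) 0%N = 1 by rewrite fps_exp0 B0 expr1n.
split=> [||i]; first by rewrite -fpsBE !expr0 !mulr1 topX.
  rewrite -[LHS]fpsBE split_mul fpsDE (fps_mul_low _ lowX') fps_exp0 expr1 S0 mulr0.
  rewrite add0r !expr1 fps_mul_low ?X0 ?mulr1 ?fpsBE // => k kd.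
  by rewrite fpsBE (ST _ kd) subrr.
have lowP k : (k <= d)%N -> (S ^+ i.+2 - T ^+ i.+2) k = 0.
  by move=> kd; rewrite fpsBE (fps_exp_sub_low0 i S0 T0 ST kd) subrr.
apply/eqP; rewrite -subr_eq0 -fpsBE split_mul fpsDE (fps_mul_low _ lowX').
rewrite fps_exp0 S0 expr0n mulr0 add0r fps_mul_low => [|k kd].
  by rewrite (lowP _ (leqnn _)) mul0r.
exact: lowP (ltnW kd).
Qed.

Lemma fps_exp_coefs A m : A 0%N = 1 ->
  [/\ (A ^+ m) 1%N = A 1%N *+ m,
      (A ^+ m) 2 = A 2 *+ m + A 1%N ^+ 2 * 'C(m, 2)%:R
    & (A ^+ m) 3 = A 3 *+ m + A 1%N * A 2 * (2 * 'C(m, 2)%:R)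
                   + A 1%N ^+ 3 * 'C(m, 3)%:R].
Proof.
move=> A0; elim: m => [|m [IH1 IH2 IH3]].
  by rewrite expr0 !fps1E; split; rewrite ?mulr0n ?mulr0 ?addr0.
have m0 : (A ^+ m) 0%N = 1 by rewrite fps_exp0 A0 expr1n.
rewrite exprS fps_coef1 fps_coef2 fps_coef3 A0 m0 IH1 IH2 IH3 !binS bin1.
by split; ring.
Qed.

Lemma mixed_coef1 A S j : A 0%N = 1 -> S 0%N = 0 ->
  mixed_coef A S j 0 1 = A 1%N *+ j.+1 /\ mixed_coef A S j 1 1 = - S 1%N.
Proof.
move=> A0 S0; have [e1 _ _] := fps_exp_coefs j.+1 A0.
have X0 : (A ^+ j.+1) 0%N = 1 by rewrite fps_exp0 A0 expr1n.
rewrite /mixed_coef expr0 mulr1 e1 expr1; split=> //.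
by rewrite fps_coef1 X0 !fpsNE S0; ring.
Qed.

Lemma mixed_coef2 A S j : A 0%N = 1 -> S 0%N = 0 ->
  [/\ mixed_coef A S j 0 2 = A 2 *+ j.+1 + A 1%N ^+ 2 * 'C(j.+1, 2)%:R,
      mixed_coef A S j 1 2 = - (S 2 + (A 1%N * S 1%N) *+ j.+1)
    & mixed_coef A S j 2 2 = S 1%N ^+ 2].
Proof.
move=> A0 S0; have [e1 e2 _] := fps_exp_coefs j.+1 A0.
have X0 : (A ^+ j.+1) 0%N = 1 by rewrite fps_exp0 A0 expr1n.
rewrite /mixed_coef expr0 mulr1 e2 expr1 expr2; split=> //.
  by rewrite fps_coef2 X0 e1 !fpsNE S0; ring.
by rewrite !(fps_coef2, fps_coef1, fps_mul0) X0 !fpsNE S0; ring.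
Qed.

Lemma mixed_coef3 A S j : A 0%N = 1 -> S 0%N = 0 ->
  [/\ mixed_coef A S j 0 3 = A 3 *+ j.+1 + A 1%N * A 2 * (2 * 'C(j.+1, 2)%:R)
                             + A 1%N ^+ 3 * 'C(j.+1, 3)%:R,
      mixed_coef A S j 1 3 = - (S 3 + (A 1%N * S 2) *+ j.+1
         + (A 2 *+ j.+1 + A 1%N ^+ 2 * 'C(j.+1, 2)%:R) * S 1%N),
      mixed_coef A S j 2 3 = (S 1%N * S 2) *+ 2 + (A 1%N * S 1%N ^+ 2) *+ j.+1
    & mixed_coef A S j 3 3 = - S 1%N ^+ 3].
Proof.
move=> A0 S0; have [e1 e2 e3] := fps_exp_coefs j.+1 A0.
have X0 : (A ^+ j.+1) 0%N = 1 by rewrite fps_exp0 A0 expr1n.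
rewrite /mixed_coef expr0 mulr1 e3 expr1 (exprS _ 2) expr2; split=> //.
- by rewrite fps_coef3 X0 e1 e2 !fpsNE S0; ring.
- by rewrite !(fps_coef3, fps_coef2, fps_coef1, fps_mul0) X0 e1 !fpsNE S0; ring.
by rewrite !(fps_coef3, fps_coef2, fps_coef1, fps_mul0) X0 !fpsNE S0; ring.
Qed.
End LowOrder.

Section Converse.
Variable K : numFieldType.
Implicit Types (P : nat -> {poly K}) (D : gf_data K).

Lemma coef_gf_term (A R : fps K) k n j :
  ((fps_polyC A * ('X *: ('t * fps_polyC A) - fps_polyC R) ^+ k) n)`_j
  = if (j <= k)%N && (j <= n)%N
    then 'C(k, j)%:R * mixed_coef A R j (k - j) (n - j) else 0.
Proof.
rewrite /mixed_coef.
rewrite addrC -rmorphN exprDn mulr_sumr fps_coef_sum coef_sum.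
have term (i : nat) : ((fps_polyC A * ((fps_polyC (- R) ^+ (k - i)
      * ('X *: ('t * fps_polyC A)) ^+ i) *+ 'C(k, i))) n)`_j
    = if (i <= n)%N && (j == i)
      then 'C(k, i)%:R * (A ^+ i.+1 * (- R) ^+ (k - i)) (n - i)%N else 0.
  rewrite mulrnAr fps_coef_mulrn exprZn exprMn -!scalerAr fpsZE.
  have -> : fps_polyC A * (fps_polyC (- R) ^+ (k - i)
              * ('t ^+ i * fps_polyC A ^+ i))
          = 't ^+ i * fps_polyC (A ^+ i.+1 * (- R) ^+ (k - i)).
    rewrite (rmorphM (@fps_polyC K)) !(rmorphXn (@fps_polyC K)) exprS; ring.
  rewrite fps_mul_tX; case: leqP => _ /=; last by rewrite mulr0 mul0rn coef0.
  rewrite coefMn coefMC coefXn; case: eqP => _; last by rewrite mul0r mul0rn.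
  by rewrite mul1r mulr_natl.
under eq_bigr => i _ do rewrite term.
rewrite -big_mkcond /=.
case: (leqP j k) => jk /=; last first.
  by rewrite big1 // => i /andP[_ /eqP ji]; rewrite ji ltnNge -ltnS ltn_ord in jk.
case: (leqP j n) => jn; last first.
  by rewrite big1 // => i /andP[ni /eqP ji]; rewrite ji ltnNge ni in jn.
rewrite (big_pred1 (Ordinal (jk : (j < k.+1)%N))) // => i /=.
by rewrite -val_eqE /= eq_sym; case: eqP => [->|]; rewrite ?jn ?andbF.
Qed.

(** The coefficient of [x^j t^(j+d)] in the defining identity. *)
Lemma gf_coef_eq P D j d : is_gf P D ->
  gf_coef D (j + d) * (P (j + d)%N)`_j
  = \sum_(i < d.+1) gf_coef D (j + i) * 'C(j + i, j)%:R
      * mixed_coef (gf_A D) (gf_R D) j i d.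
Proof.
case=> _ _ _ FE A0 R0 /(congr1 (fun U : fps {poly K} => (U (j + d)%N)`_j)).
rewrite [in RHS]/= coefZ => <-.
rewrite fps_mul_comp; last first.
  rewrite fpsBE fpsZE fps_mul0 mul0r mulr0 sub0r.
  by rewrite -[fps_coef _ _]/((gf_R D 0)%:P) R0 oppr0.
rewrite coef_sum -addnS big_split_ord /= [X in X + _]big1 ?add0r => [|i _]; last first.
  by rewrite coefCM coef_gf_term leqNgt ltn_ord mulr0.
apply: eq_bigr => i _.
by rewrite coefCM coef_gf_term !leq_addr FE !addKn mulrA.
Qed.

(** In degree [d] the coefficients [A_d] and [R_d] enter the identity for
    [x^j t^(j+d)] through [(j+1) (a_j A_d - a_(j+1) R_d)] only; the identities
    for [j = 0] and [j = 1] determine both as soon as [a_1^2 <> a_0 a_2]. *)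
Lemma gf_uniq P D D' : is_gf P D -> is_gf P D' ->
  (forall n, gf_coef D n = gf_coef D' n) ->
  gf_coef D 1 ^+ 2 != gf_coef D 2 -> D = D'.
Proof.
move=> gfD gfD' eqa neq.
have [_ _ a0 FE A0 R0 _] := gfD; have [_ _ _ FE' A0' R0' _] := gfD'.
suff AR d : gf_A D d = gf_A D' d /\ gf_R D d = gf_R D' d.
  have eqA : gf_A D = gf_A D' by apply: fps_ext => d; case: (AR d).
  have eqR : gf_R D = gf_R D' by apply: fps_ext => d; case: (AR d).
  have eqc : gf_coef D = gf_coef D' by apply/funext.
  move: FE FE' eqA eqR eqc; case: D {gfD neq A0 R0 eqa a0 AR} => a A R F.
  by case: D' {gfD' A0' R0'} => a' A' R' F' /= -> -> -> -> ->.
elim/ltn_ind: d => -[|d] IH.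
  by split; [exact: etrans A0 (esym A0') | exact: etrans R0 (esym R0')].
have lowA k : (k < d.+1)%N -> gf_A D k = gf_A D' k by move=> kd; case: (IH k kd).
have lowR k : (k < d.+1)%N -> gf_R D k = gf_R D' k by move=> kd; case: (IH k kd).
set x := gf_A D d.+1 - gf_A D' d.+1; set y := gf_R D d.+1 - gf_R D' d.+1.
have key j : gf_coef D j * x = gf_coef D j.+1 * y.
  have := etrans (esym (gf_coef_eq j d.+1 gfD))
    (etrans (congr1 ( *%R^~ _) (eqa (j + d.+1)%N)) (gf_coef_eq j d.+1 gfD')).
  have [t0 t1 t2] := mixed_coef_sub j A0 A0' R0 R0' lowA lowR.
  move=> /eqP; rewrite -subr_eq0 -sumrB 2!big_ord_recl big1 => [|i _]; last first.
    by rewrite !lift0 eqa t2 subrr.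
  rewrite -!eqa -!mulrBr t0 lift0 t1 addr0 addn0 addn1 binn binSn mulr1 -/x.
  move=> /eqP e; have j0 : j.+1%:R != 0 :> K by rewrite pnatr_eq0.
  by apply: (mulIf j0); apply: (eq_from_diff e); rewrite /y -mulr_natr; ring.
have [e0 e1] := (key 0%N, key 1%N).
have {}e0 : x = gf_coef D 1 * y by rewrite -e0 [gf_coef D 0]a0 mul1r.
have /eqP : (gf_coef D 1 ^+ 2 - gf_coef D 2) * y = 0.
  by rewrite mulrBl -e1 e0; ring.
rewrite mulf_eq0 subr_eq0 (negPf neq) /= => /eqP y0.
by split; apply/eqP; rewrite -subr_eq0 -/x -/y ?e0 y0 ?mulr0.
Qed.

Lemma bin_low j :
  [/\ 'C(j + 1, j)%:R = j.+1%:R :> K,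
      'C(j + 2, j)%:R = j.+1%:R * j.+2%:R / 2 :> K
    & 'C(j + 3, j)%:R = j.+1%:R * j.+2%:R * j.+3%:R / 6 :> K].
Proof.
have nz : j`!%:R != 0 :> K by rewrite pnatr_eq0 -lt0n fact_gt0.
have f1 : (j + 1)`!%:R = j.+1%:R * j`!%:R :> K by rewrite addn1 factS natrM.
have f2 : (j + 2)`!%:R = j.+2%:R * (j + 1)`!%:R :> K by rewrite addn2 addn1 factS natrM.
have f3 : (j + 3)`!%:R = j.+3%:R * (j + 2)`!%:R :> K by rewrite addn3 addn2 factS natrM.
rewrite !bin_fact_div f3 f2 f1 (_ : 1`! = 1)%N // (_ : 2`! = 2)%N // (_ : 3`! = 6)%N //.
by move: (j`!%:R) nz => f nz; split; field.
Qed.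

Lemma binS_low j :
  'C(j.+1, 2)%:R = j.+1%:R * j%:R / 2 :> K
  /\ 'C(j.+1, 3)%:R = j.+1%:R * j%:R * (j%:R - 1) / 6 :> K.
Proof.
elim: j => [|j [IH2 IH3]]; first by rewrite !mulr0 !mul0r.
by rewrite binS natrD [in X in _ /\ X]binS natrD IH3 IH2 bin1; split; field.
Qed.

Section Equations.
Variables (P : nat -> {poly K}) (D : gf_data K).
Hypothesis gfD : is_gf P D.
Let a := gf_coef D.
Let A1 := gf_A D 1%N.
Let A2 := gf_A D 2.
Let A3 := gf_A D 3.
Let r1 := gf_R D 1%N.
Let r2 := gf_R D 2.
Let r3 := gf_R D 3.

Lemma gf_eq1 j : a j.+1 * (P j.+1)`_j = j.+1%:R * (a j * A1 - a j.+1 * r1).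
Proof.
have [_ _ _ _ A0 R0 _] := gfD; have [b1 _ _] := bin_low j.
have := gf_coef_eq j 1 gfD; rewrite 2!big_ord_recl big_ord0 lift0 /=.
have [-> ->] := mixed_coef1 j A0 R0.
rewrite b1 !addn1 addn0 binn mulr1 addr0 => ->.
by rewrite -/a -/A1 -/r1 -mulr_natr; ring.
Qed.

Lemma gf_eq2 j (m := j.+1%:R : K) :
  a j.+2 * (P j.+2)`_j
  = a j * (m * A2 + m * (m - 1) / 2 * A1 ^+ 2) - a j.+1 * m * (r2 + m * A1 * r1)
    + a j.+2 * (m * (m + 1) / 2) * r1 ^+ 2.
Proof.
have [_ _ _ _ A0 R0 _] := gfD.
have [b1 b2 _] := bin_low j; rewrite addn1 addn2 in b1 b2.
have [c2 _] := binS_low j.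
have := gf_coef_eq j 2 gfD; rewrite 3!big_ord_recl big_ord0 !lift0 /=.
have [-> -> ->] := mixed_coef2 j A0 R0.
rewrite !addn1 addn0 addn2 binn b1 b2 mulr1 addr0 => ->.
rewrite -/a -/A1 -/A2 -/r1 -/r2 c2 /m.
by field.
Qed.

Lemma gf_eq3 j (m := j.+1%:R : K) :
  a j.+3 * (P j.+3)`_j
  = a j * (m * A3 + m * (m - 1) * A1 * A2 + m * (m - 1) * (m - 2) / 6 * A1 ^+ 3)
    - a j.+1 * m * (r3 + m * A1 * r2 + (m * A2 + m * (m - 1) / 2 * A1 ^+ 2) * r1)
    + a j.+2 * (m * (m + 1) / 2) * (2 * r1 * r2 + m * A1 * r1 ^+ 2)
    - a j.+3 * (m * (m + 1) * (m + 2) / 6) * r1 ^+ 3.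
Proof.
have [_ _ _ _ A0 R0 _] := gfD.
have [b1 b2 b3] := bin_low j; rewrite addn1 addn2 addn3 in b1 b2 b3.
have [c2 c3] := binS_low j.
have := gf_coef_eq j 3 gfD; rewrite 4!big_ord_recl big_ord0 !lift0 /=.
have [-> -> -> ->] := mixed_coef3 j A0 R0.
rewrite !addn1 addn0 addn2 addn3 binn b1 b2 b3 mulr1 addr0 => ->.
rewrite -/a -/A1 -/A2 -/A3 -/r1 -/r2 -/r3 c2 c3 /m.
by field.
Qed.
End Equations.
End Converse.

(** * Elimination *)

Section PolynomialFunctions.
Variable K : numFieldType.

(** Identities in [n] are continued from the integers to the whole field;
    working with functions rather than with elements of [{poly K}] keeps them
    in the form in which they are evaluated. *)
Definition polyfun (f : K -> K) := exists p : {poly K}, forall x, p.[x] = f x.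

Lemma polyfun_id : polyfun id.
Proof. by exists 'X => x; rewrite hornerX. Qed.

Lemma polyfun_cst c : polyfun (fun=> c).
Proof. by exists c%:P => x; rewrite hornerC. Qed.

Lemma polyfunD f g : polyfun f -> polyfun g -> polyfun (fun x => f x + g x).
Proof. by move=> [p fp] [q gq]; exists (p + q) => x; rewrite hornerD fp gq. Qed.

Lemma polyfunN f : polyfun f -> polyfun (fun x => - f x).
Proof. by move=> [p fp]; exists (- p) => x; rewrite hornerN fp. Qed.

Lemma polyfunM f g : polyfun f -> polyfun g -> polyfun (fun x => f x * g x).
Proof. by move=> [p fp] [q gq]; exists (p * q) => x; rewrite hornerM fp gq. Qed.

Lemma polyfun_vanish c f : polyfun f -> (forall j : nat, f (2 * j%:R + c) = 0) ->
  forall x, f x = 0.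
Proof.
move=> [p fp] f0 x; rewrite -fp; suff -> : p = 0 by rewrite horner0.
apply/eqP; apply: contraT => p0.
pose rs : seq K := [seq 2 * j%:R + c | j <- iota 0 (size p)].
have := max_poly_roots p0 (rs := rs); rewrite size_map size_iota ltnn; apply.
  by apply/allP => y /mapP[j _ ->]; rewrite rootE fp f0.
rewrite map_inj_uniq ?iota_uniq // => i j /addIr.
move=> /(mulfI (_ : 2 != 0 :> K)); rewrite pnatr_eq0 => /(_ isT)/eqP.
by rewrite eqr_nat => /eqP.
Qed.

End PolynomialFunctions.

Ltac polyfun_tac := repeat first
  [ exact: polyfun_cst | exact: polyfun_id | apply: polyfunD
  | apply: polyfunN | apply: polyfunM ].

Section Elimination.
Variable K : numFieldType.
Implicit Types (s dl r N n m : K).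

(** What remains of the identities for [x^(n-2) t^n] and [x^(n-3) t^n] after
    clearing denominators, with [N = 2 n + alpha + beta], [r = R_1] and
    [dl = alpha - beta]: the whole equation for the former, the contribution
    of the generating function for the latter. Here [a2 = A_2 / A_1^2],
    [a3 = A_3 / A_1^3], [rho = R_2 / A_1] and [rho3 = R_3 / A_1^2]. *)
Definition second_order dl r a2 rho n N : K :=
  n * (N - dl * dl) * (N - 2)
  + (N - 1) * ((r * N + dl) * (r * (N - 2) + dl) * (2 * a2 + n - 2)
               - 2 * (r * N + dl) * (N - 2) * (rho + (n - 1) * r)
               + N * (N - 2) * n * (r * r)).

Definition third_order_bracket dl r a2 a3 rho rho3 n N : K :=
  (r * N + dl) * (r * (N - 2) + dl) * (r * (N - 4) + dl)
    * (6 * a3 + 6 * (n - 3) * a2 + (n - 3) * (n - 4))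
  - 6 * (r * N + dl) * (r * (N - 2) + dl) * (N - 4)
    * (rho3 + (n - 2) * rho + ((n - 2) * a2 + (n - 2) * (n - 3) / 2) * r)
  + 3 * (r * N + dl) * (N - 2) * (N - 4) * (n - 1)
    * (2 * r * rho + (n - 2) * (r * r))
  - N * (N - 2) * (N - 4) * n * (n - 1) * (r * r * r).

(** The first two equations express the coefficients [c_i] of [F] through one
    another, see [gf_ratio] below; the last one compares [gf_eq2] with
    the coefficient of [x^(n-2)] in the Jacobi polynomial of degree
    [n = m + 1]. *)
Lemma second_order_clear m N dl r A1 A2 r2 c0 c1 c2 :
  m != 0 -> N != 0 -> N - 1 != 0 -> N - 2 != 0 -> A1 != 0 -> c2 != 0 ->
  c1 * A1 * N = c2 * (r * N + dl) ->
  c0 * A1 * (N - 2) = c1 * (r * (N - 2) + dl) ->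
  c2 * (- (m * (m + 1) * (N - dl ^+ 2)) / (2 * N * (N - 1)))
  = c0 * (m * A2 + m * (m - 1) / 2 * A1 ^+ 2) - c1 * m * (r2 + m * A1 * r)
    + c2 * (m * (m + 1) / 2) * r ^+ 2 ->
  second_order dl r (A2 / A1 ^+ 2) (r2 / A1) (m + 1) N = 0.
Proof.
move=> m0 N0 N1 N2 A10 c20 e1 e0 e.
have A1N : A1 * N != 0 by rewrite mulf_neq0.
have A1N2 : A1 * (N - 2) != 0 by rewrite mulf_neq0.
rewrite -mulrA in e1; rewrite -mulrA in e0.
have {}e1 := canRL (mulfK A1N) e1; have {}e0 := canRL (mulfK A1N2) e0.
apply: (mulfI c20).
apply: (eq_from_diff (congr1 ( *%R (2 * N * (N - 1) * (N - 2) / m)) (esym e))).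
rewrite /second_order e0 e1; field.
by rewrite N2 A10 N0 N1 m0.
Qed.

Lemma third_order_clear m N dl r A1 A2 A3 r2 r3 c0 c1 c2 c3 :
  m != 0 -> N != 0 -> N - 1 != 0 -> N - 2 != 0 -> N - 4 != 0 ->
  A1 != 0 -> c3 != 0 ->
  c2 * A1 * N = c3 * (r * N + dl) ->
  c1 * A1 * (N - 2) = c2 * (r * (N - 2) + dl) ->
  c0 * A1 * (N - 4) = c1 * (r * (N - 4) + dl) ->
  c3 * (- (m * (m + 1) * (m + 2) * dl * (3 * N - 2 - dl ^+ 2))
          / (6 * N * (N - 1) * (N - 2)))
  = c0 * (m * A3 + m * (m - 1) * A1 * A2 + m * (m - 1) * (m - 2) / 6 * A1 ^+ 3)
    - c1 * m * (r3 + m * A1 * r2 + (m * A2 + m * (m - 1) / 2 * A1 ^+ 2) * r)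
    + c2 * (m * (m + 1) / 2) * (2 * r * r2 + m * A1 * r ^+ 2)
    - c3 * (m * (m + 1) * (m + 2) / 6) * r ^+ 3 ->
  (m + 1) * (m + 2) * dl * (3 * N - 2 - dl * dl) * (N - 4)
  + (N - 1) * third_order_bracket dl r (A2 / A1 ^+ 2) (A3 / A1 ^+ 3) (r2 / A1)
      (r3 / A1 ^+ 2) (m + 2) N = 0.
Proof.
move=> m0 N0 N1 N2 N4 A10 c30 e2 e1 e0 e.
have A1N : A1 * N != 0 by rewrite mulf_neq0.
have A1N2 : A1 * (N - 2) != 0 by rewrite mulf_neq0.
have A1N4 : A1 * (N - 4) != 0 by rewrite mulf_neq0.
rewrite -mulrA in e2; rewrite -mulrA in e1; rewrite -mulrA in e0.
have {}e2 := canRL (mulfK A1N) e2; have {}e1 := canRL (mulfK A1N2) e1.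
have {}e0 := canRL (mulfK A1N4) e0.
apply: (mulfI c30).
apply: (eq_from_diff
  (congr1 ( *%R (6 * N * (N - 1) * (N - 2) * (N - 4) / m)) (esym e))).
rewrite /third_order_bracket e0 e1 e2; field.
by rewrite N2 A10 N0 N1 m0 N4.
Qed.

(** Before denominators were cleared the equation was an identity of rational
    functions of [N]; the first, second and last conclusions are its residues
    at the poles [N = 1], [N = 2] and [N = 0], and the third one is its value
    at infinity. *)
Lemma second_order_roots s dl r a2 rho : dl != 0 ->
  (forall N, second_order dl r a2 rho ((N - s) / 2) N = 0) ->
  [/\ (s - 1) * (dl ^+ 2 - 1) = 0, (2 * r + dl) * (4 * a2 - (2 + s)) = 0,
      4 * r * (r * a2 - rho) = -1
    & s * dl + (dl - 2 * r) * (2 * a2 - s / 2 - 2) + 4 * rho - 2 * s * r - 4 * r = 0].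
Proof.
move=> dl0 F; have [[F0 F1] [F2 F3]] := ((F 0, F 1), (F 2, F 3)).
rewrite /second_order in F0 F1 F2 F3; split.
- by apply: (eq_from_diff (congr1 ( *%R (-2)) F1)); field.
- apply: (mulfI dl0); by apply: (eq_from_diff (congr1 ( *%R 2) F2)); field.
(* The polynomial is cubic in [N]; its third difference isolates the leading
   coefficient. *)
- have := congr1 ( *%R (1 / 3))
    (congr2 +%R (congr2 +%R F3 (congr1 ( *%R (-3)) F2))
                (congr2 +%R (congr1 ( *%R 3) F1) (congr1 -%R F0))).
  by move=> /eq_from_diff; apply; field.
- apply: (mulfI dl0); by apply: (eq_from_diff (congr1 -%R F0)); field.
Qed.

(** The equation of second order leaves [s = 1] or [dl^2 = 1] on the one hand,
    and [r = - dl / 2] or [s r^2 + dl (1 - s) r = 1] on the other. The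
    equation of third order, evaluated where the unknowns [a3] and [rho3]
    drop out, removes the spurious solutions: at [N = 2] if [r = - dl / 2],
    and at [N = 1] if [r = dl]. *)
Lemma classify_parameters s dl r a2 a3 rho rho3 : dl != 0 -> r * (2 + s) + dl != 0 ->
  (forall N, second_order dl r a2 rho ((N - s) / 2) N = 0) ->
  (forall N, ((N - s) / 2 - 1) * ((N - s) / 2) * dl * (3 * N - 2 - dl * dl) * (N - 4)
     + (N - 1) * third_order_bracket dl r a2 a3 rho rho3 ((N - s) / 2) N = 0) ->
  (s = 1 /\ r ^+ 2 = 1) \/ [/\ dl ^+ 2 = 1, s != 0 & r = - dl / s].
Proof.
move=> dl0 q1 /(second_order_roots dl0)[e1 e2 e3 e4] T.
have two0 : 2 != 0 :> K by rewrite pnatr_eq0.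
move: e2 => /eqP; rewrite mulf_eq0 => /orP[/eqP rE|/eqP a2E].
  (* At [N = 2] the factor [r N + dl] vanishes, and so does the bracket. *)
  have {}rE : r = - dl / 2 by apply: (mulfI two0); apply: (eq_from_diff rE); field.
  have : s * (s - 2) * (4 - dl ^+ 2) = 0.
    apply: (mulfI dl0); apply: (eq_from_diff (congr1 ( *%R (-2)) (T 2))).
    by rewrite /third_order_bracket rE; field.
  move=> /eqP; rewrite !mulf_eq0 -orbA => /or3P[/eqP s0|/eqP s2|/eqP d4].
  - by move: q1; rewrite s0 rE addr0 mulfVK // addNr eqxx.
  - have {}s2 : s = 2 by apply: (eq_from_diff s2); ring.
    right; rewrite s2; split=> //.
    by apply: (eq_from_diff e1); rewrite s2; ring.
  - have {}d4 : dl ^+ 2 = 4 by apply: (eq_from_diff (congr1 -%R d4)); ring.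
    left; split; last by rewrite rE expr_div_n sqrrN d4; field.
    have three0 : 3 != 0 :> K by rewrite pnatr_eq0.
    by apply: (mulfI three0); apply: (eq_from_diff e1); rewrite d4; ring.
have {}a2E : a2 = (2 + s) / 4.
  have four0 : 4 != 0 :> K by rewrite pnatr_eq0.
  by apply: (mulfI four0); apply: (eq_from_diff a2E); field.
have quad : s * r ^+ 2 + dl * (1 - s) * r - 1 = 0.
  have rrho : r * rho = r ^+ 2 * a2 + 1 / 4.
    by apply: (eq_from_diff (congr1 ( *%R (- (1 / 4))) e3)); field.
  transitivity (s * r ^+ 2 + dl * (1 - s) * r - 1
    + r * (s * dl + (dl - 2 * r) * (2 * a2 - s / 2 - 2) + 4 * rho - 2 * s * r - 4 * r)).
    by rewrite e4 mulr0 addr0.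
  by rewrite !mulrDr (mulrCA r 4) rrho a2E; field.
move: (e1) => /eqP; rewrite mulf_eq0 => /orP[/eqP s1|/eqP d1].
  have {}s1 : s = 1 by apply: (eq_from_diff s1); ring.
  by left; split=> //; apply: (eq_from_diff quad); rewrite s1; ring.
have {}d1 : dl ^+ 2 = 1 by apply: (eq_from_diff d1); ring.
have sr (s0r : s * r = - dl) : [/\ dl ^+ 2 = 1, s != 0 & r = - dl / s].
  have s0 : s != 0.
    by apply: contra_neq dl0 => s0; rewrite -[dl]opprK -s0r s0 mul0r oppr0.
  by split=> //; rewrite -s0r mulrAC mulfV ?mul1r.
(* As [dl^2 = 1], the quadratic equation for [r] splits. *)
have /eqP : (s * r + dl) * (r - dl) = 0.
  by apply: (eq_from_diff (congr2 +%R quad (congr1 -%R d1))); ring.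
rewrite mulf_eq0 => /orP[|/eqP rd].
  by rewrite addr_eq0 => /eqP s0r; right; exact: sr.
have {}rd : r = dl by apply: (eq_from_diff rd); ring.
(* As [dl^2 = 1], the factor [N - 1] divides the equation of third order; only
   after the division does [N = 1] give information. *)
have T' N : 3 * ((N - s) / 2 - 1) * ((N - s) / 2) * dl * (N - 4)
    + third_order_bracket dl r a2 a3 rho rho3 ((N - s) / 2) N = 0.
  move: N; apply: (polyfun_vanish (c := 2)).
    by rewrite /third_order_bracket; polyfun_tac.
  move=> j; set N := 2 * j%:R + 2.
  have N1 : N - 1 != 0.
    have e : j.*2.+1%:R = 2 * j%:R + 1 :> K by rewrite -addn1 natrD -mul2n natrM.
    have -> : N - 1 = j.*2.+1%:R by rewrite e /N; ring.
    by rewrite pnatr_eq0.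
  apply: (mulfI N1); apply: (eq_from_diff (T N)); rewrite -expr2 d1; ring.
have rho_dl : dl * rho = (s + 3) / 4.
  have e : 4 * (dl ^+ 2 * a2 - dl * rho) = -1 by rewrite -e3 rd; ring.
  rewrite d1 a2E in e.
  by apply: (eq_from_diff (congr1 ( *%R (- (1 / 4))) e)); field.
have : (1 + s) * (1 - s) = 0.
  apply: (mulfI dl0); have := T' 1; set n := (1 - s) / 2.
  have -> : 3 * (n - 1) * n * dl * (1 - 4)
      + third_order_bracket dl r a2 a3 rho rho3 n 1
    = dl * (- (9 * n * (n - 1))
            + 18 * (n - 1) * (2 * (dl * rho) + (n - 2) * dl ^+ 2)
            - 3 * n * (n - 1) * dl ^+ 2).
    by rewrite /third_order_bracket rd; field.
  rewrite rho_dl d1 => e.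
  by apply: (eq_from_diff (congr1 ( *%R (1 / 3)) e)); rewrite /n; field.
move=> /eqP; rewrite mulf_eq0 => /orP[/eqP s1|/eqP s1].
  right; apply: sr; rewrite rd; apply: (eq_from_diff (congr1 ( *%R dl) s1)); ring.
left; split; last by rewrite rd.
by apply: (eq_from_diff (congr1 -%R s1)); ring.
Qed.
End Elimination.

(** * Classification *)

Section Classification.
Variable K : numFieldType.
Implicit Types (P : nat -> {poly K}) (D L : gf_data K).

(** The ratios of its consecutive coefficients determine [F], and by [gf_uniq]
    the coefficients of [F] determine [A] and [R]. *)
Lemma gf_determined P D L c (u v : nat -> K) : is_gf P D -> is_gf P L ->
  c != 0 -> (forall j, v j != 0) ->
  (forall j, gf_coef D j * u j = gf_coef D j.+1 * v j) ->
  (forall j, gf_coef L j * u j = c * gf_coef L j.+1 * v j) ->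
  gf_coef D 1 ^+ 2 != gf_coef D 2 -> D = gf_rescale c L.
Proof.
move=> gfD gfL c0 v0 eD eL neq; have gfL' := gf_rescaleP c0 gfL.
apply: (gf_uniq gfD gfL') => //; elim=> [|n IH].
  by rewrite (gf_coef0 gfD) (gf_coef0 gfL').
apply: (mulIf (v0 n)); rewrite -eD IH /= -mulrA eL exprS; ring.
Qed.

Variables alpha beta : K.
Hypothesis adm : admissible (alpha + beta).
Let s := alpha + beta.
Let dl := alpha - beta.
Let P := jacobi alpha beta.

Let top n : (P n)`_n = 1 /\ (P n)`_n.+1 = 0.
Proof.
have [/monicP] := jacobi_mps adm n; rewrite lead_coefE => e sz.
by move: e; rewrite sz => ->; rewrite nth_default // sz.
Qed.

Let shift_neq0 m : 2 * m.+1%:R + s != 0.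
Proof.
rewrite addrC -natrM mulnS; exact: admissible_neq0.
Qed.

Let shift1_neq0 m : 2 * m.+2%:R + s - 1 != 0.
Proof.
have := admissible_neq0 m.*2.+1 adm; congr (_ != 0); rewrite -/s.
by rewrite -addn3 natrD -mul2n natrM; ring.
Qed.

Lemma jacobi_coef1 j : (P j.+1)`_j = dl * j.+1%:R / (2 * j.+1%:R + s).
Proof.
have := jacobi_coef_rec adm j.+1 j; have [-> ->] := top j.+1.
move=> e; apply: (canRL (mulfK (shift_neq0 j))).
by apply: (eq_from_diff e); rewrite /s /dl; ring.
Qed.

Lemma jacobi_coef2 j (m := j.+1%:R : K) (N := 2 * (m + 1) + s) :
  (P j.+2)`_j = - (m * (m + 1) * (N - dl ^+ 2)) / (2 * N * (N - 1)).
Proof.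
have := jacobi_coef_rec adm j.+2 j; have [-> _] := top j.+2.
rewrite -/P jacobi_coef1 => e.
have N0 : N != 0 by rewrite /N natr1 shift_neq0.
have N1 : N - 1 != 0 by rewrite /N natr1 shift1_neq0.
have N10 : 2 * (N - 1) != 0 by rewrite mulf_neq0 ?pnatr_eq0.
transitivity ((dl * m * (dl * (m + 1) / N) - (m + 1) * m) / (2 * (N - 1))).
  have NE : 2 * j.+2%:R + s = N by rewrite /N natr1.
  have kE : (j.+2%:R - j%:R) * (j.+2%:R + j%:R + (alpha + beta) + 1) = 2 * (N - 1).
    by rewrite /N /m /s; ring.
  rewrite kE NE in e; clear NE kE; move: N e N0 N1 N10 => N e N0 N1 N10.
  by apply: (canRL (mulfK N10)); apply: (eq_from_diff e); rewrite /m /dl; ring.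
by field; rewrite N0 N1.
Qed.

Lemma jacobi_coef3 j (m := j.+1%:R : K) (N := 2 * (m + 2) + s) :
  (P j.+3)`_j = - (m * (m + 1) * (m + 2) * dl * (3 * N - 2 - dl ^+ 2))
                / (6 * N * (N - 1) * (N - 2)).
Proof.
have := jacobi_coef_rec adm j.+3 j.
rewrite -/P jacobi_coef1 jacobi_coef2 => e.
have mE k : m + k%:R = (j.+1 + k)%:R by rewrite /m natrD.
have N0 : N != 0 by rewrite /N mE addn2 shift_neq0.
have N1 : N - 1 != 0 by rewrite /N mE addn2 shift1_neq0.
have N2 : N - 2 != 0.
  by rewrite (_ : N - 2 = 2 * j.+2%:R + s) ?shift_neq0 // /N /m; ring.
have N30 : 3 * (N - 2) != 0 by rewrite mulf_neq0 ?pnatr_eq0.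
have NE : 2 * j.+3%:R + s = N by rewrite /N mE addn2.
have NE' : 2 * (j.+2%:R + 1) + s = N by rewrite natr1 NE.
have kE : (j.+3%:R - j%:R) * (j.+3%:R + j%:R + (alpha + beta) + 1) = 3 * (N - 2).
  by rewrite /N /m /s; ring.
rewrite kE NE NE' -/dl in e; clear NE NE' kE.
move: N e N0 N1 N2 N30 => N e N0 N1 N2 N30.
transitivity ((dl * m * - ((m + 1) * (m + 2) * (N - dl ^+ 2)) / (2 * N * (N - 1))
               - (m + 1) * m * (dl * (m + 2) / N)) / (3 * (N - 2))).
  apply: (canRL (mulfK N30)); apply: (eq_from_diff e); rewrite /m; field.
  by rewrite N0 N1.
by field; rewrite N0 N1 N2.
Qed.

Hypothesis dl0 : dl != 0.

Section Data.
Variable D : gf_data K.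
Hypothesis gfD : is_gf P D.
Let a := gf_coef D.
Let A1 := gf_A D 1%N.
Let r := gf_R D 1%N.

Let a_neq0 j : a j != 0 := gf_coef_neq0 gfD j.

(** The identity for [x^j t^(j+1)]: apart from the scale [A_1], the sequence
    of coefficients of [F] has the single parameter [r = R_1]. *)
Lemma gf_ratio j : a j * (A1 * (2 * j.+1%:R + s))
  = a j.+1 * (r * (2 * j.+1%:R + s) + dl).
Proof.
have := gf_eq1 gfD j; rewrite jacobi_coef1 -/a -/A1 -/r => e.
have N0 := shift_neq0 j; have j0 : j.+1%:R != 0 :> K by rewrite pnatr_eq0.
move: e N0; set N := 2 * _ + s; move: N => N e N0.
apply: (eq_from_diff (congr1 ( *%R (N / j.+1%:R)) (esym e))).
by field; rewrite N0 nat1r j0.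
Qed.

Let shift_succ j : 2 * j.+2%:R + s = 2 * j.+1%:R + s + 2.
Proof. by rewrite -[in LHS]natr1; ring. Qed.

(** Otherwise [r N + dl] would vanish at two different values of [N]. *)
Lemma gf_A1_neq0 : A1 != 0.
Proof.
apply: contra_neq dl0 => A10.
have z j : r * (2 * j.+1%:R + s) + dl = 0.
  by apply: (mulfI (a_neq0 j.+1)); rewrite -gf_ratio A10 mul0r !mulr0.
have [e0 e1] := (z 0%N, z 1%N).
have two0 : 2 != 0 :> K by rewrite pnatr_eq0.
have r0 : r = 0.
  by apply: (mulfI two0); apply: (eq_from_diff (congr2 +%R e1 (congr1 -%R e0))); ring.
by move: e0; rewrite r0 mul0r add0r.
Qed.

Lemma gf_ratio_neq0 j : r * (2 * j.+1%:R + s) + dl != 0.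
Proof.
have : a j * (A1 * (2 * j.+1%:R + s)) != 0.
  by rewrite !mulf_neq0 ?gf_A1_neq0 ?shift_neq0.
by rewrite gf_ratio mulf_eq0 negb_or => /andP[].
Qed.

Lemma gf_coef_sqr : a 1%N ^+ 2 != a 2.
Proof.
have e0 := gf_ratio 0; have := gf_ratio 1; rewrite shift_succ.
have {}e0 : A1 * (2 * 1 + s) = a 1%N * (r * (2 * 1 + s) + dl).
  by rewrite -e0 (gf_coef0 gfD : a 0%N = 1) mul1r.
move: (shift_neq0 0); move: e0; set N := 2 * 1 + s => e0 N0 e1.
apply/eqP => e; move/eqP: dl0; apply.
rewrite -e expr2 -mulrA in e1; have {}e1 := mulfI (a_neq0 1) e1.
have two0 : 2 != 0 :> K by rewrite pnatr_eq0.
apply: (mulfI two0); apply: (mulfI (a_neq0 1)).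
apply: (eq_from_diff (congr2 +%R (congr1 ( *%R N) e1)
                       (congr1 -%R (congr1 ( *%R (N + 2)) e0)))).
by ring.
Qed.

(** The identities for [x^(n-2) t^n] and [x^(n-3) t^n] hold for infinitely many
    [n], hence as identities of polynomials in [N = 2 n + s]. *)
Lemma gf_parameters :
  (s = 1 /\ r ^+ 2 = 1) \/ [/\ dl ^+ 2 = 1, s != 0 & r = - dl / s].
Proof.
have A10 := gf_A1_neq0.
have two0 : 2 != 0 :> K by rewrite pnatr_eq0.
apply: (@classify_parameters K s dl r (gf_A D 2 / A1 ^+ 2) (gf_A D 3 / A1 ^+ 3)
          (gf_R D 2 / A1) (gf_R D 3 / A1 ^+ 2)) => //.
- by have := gf_ratio_neq0 0; rewrite mulr1.
- apply: (polyfun_vanish (c := 4 + s)) => [|j].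
    by rewrite /second_order; polyfun_tac.
  have e := gf_eq2 gfD j; rewrite jacobi_coef2 in e.
  have [e0 e1] := (gf_ratio j, gf_ratio j.+1).
  have [[N0 N1] N2] := (shift_neq0 j.+1, shift1_neq0 j, shift_neq0 j).
  have NE : 2 * j.+2%:R + s = 2 * (j.+1%:R + 1) + s by rewrite natr1.
  have NE2 : 2 * j.+1%:R + s = 2 * (j.+1%:R + 1) + s - 2 by ring.
  rewrite NE in e1 N0 N1; rewrite NE2 in e0 N2.
  have m0 : j.+1%:R != 0 :> K by rewrite pnatr_eq0.
  rewrite !mulrA in e0 e1.
  have := second_order_clear m0 N0 N1 N2 A10 (a_neq0 j.+2) e1 e0 e.
  congr (second_order _ _ _ _ _ _ = _); first by field.
  by rewrite -natr1; ring.
apply: (polyfun_vanish (c := 6 + s)) => [|j].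
  by rewrite /third_order_bracket; polyfun_tac.
have e := gf_eq3 gfD j; rewrite jacobi_coef3 in e.
have [[e0 e1] e2] := (gf_ratio j, gf_ratio j.+1, gf_ratio j.+2).
have [[N0 N1] [N2 N4]] :=
  ((shift_neq0 j.+2, shift1_neq0 j.+1), (shift_neq0 j.+1, shift_neq0 j)).
set N := 2 * (j.+1%:R + 2) + s in e.
have NE : 2 * j.+3%:R + s = N by rewrite /N -natrD addn2.
have NE2 : 2 * j.+2%:R + s = N - 2 by rewrite /N; ring.
have NE4 : 2 * j.+1%:R + s = N - 4 by rewrite /N; ring.
rewrite NE in e2 N0 N1; rewrite NE2 in e1 N2; rewrite NE4 in e0 N4.
have m0 : j.+1%:R != 0 :> K by rewrite pnatr_eq0.
rewrite !mulrA in e0 e1 e2.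
have -> : 2 * j%:R + (6 + s) = N by rewrite /N -natr1; ring.
have nE : (N - s) / 2 = j.+1%:R + 2 by rewrite /N; field.
have := third_order_clear m0 N0 N1 N2 N4 A10 (a_neq0 j.+3) e2 e1 e0 e.
rewrite nE => <-; congr (_ * _ * _ * _ * _ + _); by ring.
Qed.
End Data.
End Classification.

Section Converse.
Variable K : numFieldType.
Implicit Types (alpha beta : K) (D : gf_data K).

(** The two cases of [gf_parameters] are matched with the list: the ratios
    [a_(n+1) / a_n] of both sides agree once [c] adjusts [A_1]. *)
Lemma jacobi_gf_classification alpha beta D : alpha != beta ->
  admissible (alpha + beta) -> is_gf (jacobi alpha beta) D ->
  exists (c : K) (L : gf_data K), c != 0 /\
    ((jacobi_gf_listed alpha beta L /\ D = gf_rescale c L)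
     \/ (jacobi_gf_listed beta alpha L /\ D = gf_rescale c (gf_reflect L))).
Proof.
move=> neq adm gfD; have dl0 : alpha - beta != 0 by rewrite subr_eq0.
have two0 : 2 != 0 :> K by rewrite pnatr_eq0.
have A10 := gf_A1_neq0 adm dl0 gfD.
have ratio := gf_ratio adm gfD; have v0 := gf_ratio_neq0 adm dl0 gfD.
have sqr := gf_coef_sqr adm dl0 gfD.
have [[s1 r2]|[d2 s0 rE]] := gf_parameters adm dl0 gfD.
- have bE : beta = 1 - alpha by rewrite -s1; ring.
  set r := gf_R D 1%N in r2 ratio v0; set A1 := gf_A D 1%N in A10 ratio.
  have r_pm : r = 1 \/ r = -1.
    by move/eqP: r2; rewrite sqrf_eq1 => /orP[] /eqP; [left|right].
  have r0 : r != 0 by case: r_pm => ->; rewrite ?oppr_eq0 oner_eq0.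
  have vE j : r * (2 * j.+1%:R + (alpha + beta)) + (alpha - beta)
            = 2 * r * (jacobi_c3 alpha r + j%:R).
    by rewrite bE /jacobi_c3 -natr1; field.
  have c30 m : jacobi_c3 alpha r + m%:R != 0.
    by have := v0 m; rewrite vE mulf_eq0 negb_or => /andP[].
  have c3 m : jacobi_c3 alpha r != - m%:R by rewrite -addr_eq0.
  exists (A1 / 2), (jacobi_gf3 alpha r); split.
    by rewrite mulf_neq0 ?invr_eq0.
  left; split; first by apply: Or33; split=> //; exists r.
  have gfL : is_gf (jacobi alpha beta) (jacobi_gf3 alpha r).
    by rewrite bE; apply: jacobi_gf3P => //; rewrite -bE.
  apply: (gf_determined gfD gfL _ v0 ratio _ sqr).
    by rewrite mulf_neq0 ?invr_eq0.
  move=> j; rewrite vE s1 /= exprS /poch !big_ord_recr /= -!/(poch _ _).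
  have p0 : poch (jacobi_c3 alpha r) j != 0 by apply: poch_neq0.
  by rewrite -natr1; field; rewrite r0 c30 p0.
set A1 := gf_A D 1%N in A10 ratio.
have c10 : A1 * (alpha + beta) != 0 by rewrite mulf_neq0.
move/eqP: d2; rewrite sqrf_eq1 => /orP[]/eqP d1.
- have aE : alpha = beta + 1 by apply: (eq_from_diff d1); ring.
  have adm' : admissible (beta + (beta + 1)) by rewrite addrC -aE.
  have b12 : beta != - 2^-1.
    by apply: contra_neq s0 => bE; rewrite aE bE; field.
  exists (- (A1 * (alpha + beta))), (jacobi_gf1 beta); split.
    by rewrite oppr_eq0.
  right; split; first by apply: Or31.
  have gfL : is_gf (jacobi alpha beta) (gf_reflect (jacobi_gf1 beta)).
    by rewrite aE; apply: jacobi_gf_reflect adm' (jacobi_gf1P adm' b12).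
  apply: (gf_determined gfD gfL _ v0 ratio _ sqr); first by rewrite oppr_eq0.
  move=> j; rewrite rE d1 /= /poch big_ord_recr /= -/(poch _ _) factS natrM.
  have j0 : j.+1%:R != 0 :> K by rewrite pnatr_eq0.
  have f0 : j`!%:R != 0 :> K by rewrite pnatr_eq0 -lt0n fact_gt0.
  move: s0; rewrite aE => s0; move: (poch _ _) (j`!%:R) f0 => p f f0.
  by field; rewrite s0 f0 nat1r j0.
have bE : beta = alpha + 1 by apply: (eq_from_diff (congr1 -%R d1)); ring.
have adm' : admissible (alpha + (alpha + 1)) by rewrite -bE.
have a12 : alpha != - 2^-1.
  by apply: contra_neq s0 => aE; rewrite bE aE; field.
exists (A1 * (alpha + beta)), (jacobi_gf1 alpha); split=> //.
left; split; first by apply: Or31.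
have gfL : is_gf (jacobi alpha beta) (jacobi_gf1 alpha).
  by rewrite bE; apply: jacobi_gf1P.
apply: (gf_determined gfD gfL c10 v0 ratio _ sqr).
move=> j; rewrite rE d1 /= /poch big_ord_recr /= -/(poch _ _) factS natrM.
have j0 : j.+1%:R != 0 :> K by rewrite pnatr_eq0.
have f0 : j`!%:R != 0 :> K by rewrite pnatr_eq0 -lt0n fact_gt0.
move: s0; rewrite bE => s0; move: (poch _ _) (j`!%:R) f0 => p f f0.
by field; rewrite s0 f0 nat1r j0.
Qed.
End Converse.

Theorem theorem3p3 (R : realType) (alpha beta : R[i])
    (neq_ab : alpha != beta)
    (adm_ab : forall m : nat, alpha + beta != - m.+2%:R) :
  [/\ (* (1) *)
      beta = alpha + 1 -> alpha != - 2^-1 ->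
        is_gf (jacobi alpha beta) (jacobi_gf1 alpha) /\
        Fps (fun n => (poch (alpha + 3 / 2) n / n`!%:R) *: jacobi alpha beta n)
        = (1 - (2^-1)%:P *: 't)
          * fps_ppow (1 - 'X *: 't + (4^-1)%:P *: 't ^+ 2) (- (alpha + 3 / 2)),
      (* (2) *)
      alpha = 0 -> beta = 1 ->
        is_gf (jacobi alpha beta) (jacobi_gf2 R[i]) /\
        Fps (fun n => (poch (3 / 2) n / n.+1`!%:R) *: jacobi alpha beta n)
        = fps_polyC (fps_pow (1 + 2^-1 *: 't) (- 2))
          * fps_comp (fps_polyC (hyp2F1 (3 / 2) 1 2))
              (('X + 1) *: ('t * fps_polyC (fps_pow (1 + 2^-1 *: 't) (- 2)))),
      (* (3) *)
      forall R0 : R[i],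
        beta = 1 - alpha -> R0 = 1 \/ R0 = -1 ->
        (forall m : nat, jacobi_c3 alpha R0 != - m%:R) ->
        is_gf (jacobi alpha beta) (jacobi_gf3 alpha R0) /\
        Fps (fun n => (poch (3 / 2) n / poch (jacobi_c3 alpha R0) n
                       * (2 / R0) ^+ n) *: jacobi alpha beta n)
        = fps_polyC (fps_pow (1 - 't) (- 2))
          * fps_comp (fps_polyC (hyp2F1 (3 / 2) 1 (jacobi_c3 alpha R0)))
              (((2 / R0) *: ('X - R0%:P))
                 *: ('t * fps_polyC (fps_pow (1 - 't) (- 2))))
    & (* converse *)
      forall D : gf_data R[i], is_gf (jacobi alpha beta) D ->
        exists (c : R[i]) (L : gf_data R[i]),
          c != 0 /\
          ((jacobi_gf_listed alpha beta L /\ D = gf_rescale c L) \/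
           (jacobi_gf_listed beta alpha L /\
            D = gf_rescale c (gf_reflect L)))].
Proof.
have adm : admissible (alpha + beta) := adm_ab.
split.
- move=> bE a12; rewrite {}bE in adm *.
  by split; [apply: jacobi_gf1P | apply: jacobi_genfun1].
- move=> -> ->; split; [exact: jacobi_gf2P | exact: jacobi_genfun2].
- move=> R0 bE hR c3; rewrite {}bE in adm *.
  by split; [apply: jacobi_gf3P | apply: jacobi_genfun3].
by move=> D gfD; apply: jacobi_gf_classification.
Qed.
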